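(* Let $K$ be a Lie group with Lie algebra $\mathfrak k$, let $f$ be a scalar function defined on an open set $\mathcal U\subset\mathbb{H}^n=\mathbb{R}^{4n}$ with range contained in an interval $I\subset\mathbb{R}$, and let $T=(T_1,T_2,T_3)$ with $T_i\colon I\to\mathfrak k$. Consider the connection on a principal $K$-bundle over $\mathbb{H}^n$ (over $\mathcal U$, where $f$ is defined) given by $-\omega$, where $$\omega=\sum_{j=1}^3T_j(f)\,J^j(df).$$ If $T$ satisfies Nahm's equations $$T_i'(s)=[T_j(s),T_k(s)]\quad\text{for each cyclic permutation }(ijk)\text{ of }(123),$$ then $-\omega$ is anti-self-dual if and only if $f$ satisfies the second order equations $$d(J^i(df))\wedge\Sigma^{n-1}=c_1 * d(J^i(df)),\qquad i=1,2,3,$$ where $c_1=-(2n-1)!/2^{n-1}$.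
   Context: $\mathbb{R}^{4n}$ carries the flat metric and standard orientation, with coordinates $x_1,\dots,x_{4n}$; $dx_{p,q}=dx_p\wedge dx_q$; $*$ is the Hodge star. With $f_p=\partial f/\partial x_p$, the standard triple of complex structures acts on $df$ by $$J^1(df)=\sum_{j=0}^{n-1}\left(-f_{4j+2}dx_{4j+1}+f_{4j+1}dx_{4j+2}-f_{4j+4}dx_{4j+3}+f_{4j+3}dx_{4j+4}\right),$$ $$J^2(df)=\sum_{j=0}^{n-1}\left(-f_{4j+3}dx_{4j+1}+f_{4j+4}dx_{4j+2}+f_{4j+1}dx_{4j+3}-f_{4j+2}dx_{4j+4}\right),$$ $$J^3(df)=\sum_{j=0}^{n-1}\left(-f_{4j+4}dx_{4j+1}-f_{4j+3}dx_{4j+2}+f_{4j+2}dx_{4j+3}+f_{4j+1}dx_{4j+4}\right).$$ The fundamental $4$-form is $\Sigma=\tfrac12(\sigma_1^2+\sigma_2^2+\sigma_3^2)$, where $$\sigma_1=\sum_{j=0}^{n-1}(dx_{4j+1,4j+2}+dx_{4j+3,4j+4}),\quad \sigma_2=\sum_{j=0}^{n-1}(dx_{4j+1,4j+3}+dx_{4j+4,4j+2}),\quad \sigma_3=\sum_{j=0}^{n-1}(dx_{4j+1,4j+4}+dx_{4j+2,4j+3}).$$ A connection is called anti-self-dual on $\mathbb{H}^n$ if its curvature $2$-form $\Omega$ satisfies $\Omega\wedge\Sigma^{n-1}=c_1*\Omega$ with $c_1=-(2n-1)!/2^{n-1}$; in this case the curvature takes values in $\mathfrak{sp}(n)\sub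set\mathfrak{sp}(1)\oplus\mathfrak{sp}(n)$.
   Formalization: T is assumed not identically zero on I: for T = 0 Nahm's equations hold and -ω = 0 is anti-self-dual for every f, while e.g. f = x_1^2 (n = 1) does not satisfy the second order equations. *)

(* Defs.v *)
From HB Require Import structures.
From mathcomp Require Import all_boot all_order all_algebra.
From mathcomp Require Import all_classical all_reals all_analysis.
Set Implicit Arguments.
Unset Strict Implicit.
Unset Printing Implicit Defensive.
Import Order.TTheory GRing.Theory Num.Theory.
Import numFieldNormedType.Exports.
Local Open Scope ring_scope.

(* A V-valued exterior form on R^N with constant coefficients is the family of
   its coefficients in the basis dx_S = dx_{p_1} /\ ... /\ dx_{p_k}, where
   S = {p_1 < ... < p_k}.  All degrees are allowed: the k-forms are the families
   supported on the sets of cardinal k.  A differential form is a function from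
   R^N to this type. *)
Definition form (R : realType) (N : nat) (V : lmodType R) : lmodType R :=
  {ffun {set 'I_N} -> V}.

Section ExteriorAlgebra.
Variables (R : realType) (N : nat).
Implicit Types A B S : {set 'I_N}.

(* dx_A /\ dx_B = shuffle_sign A B *: dx_(A :|: B) when A and B are disjoint. *)
Definition shuffle_sign A B : R :=
  (-1) ^+ #|[set p : 'I_N * 'I_N | [&& p.1 \in A, p.2 \in B & (p.2 < p.1)%N]]|.

(* m is the pairing of the coefficients. *)
Definition wedge (V W X : lmodType R) (m : V -> W -> X)
    (a : form N V) (b : form N W) : form N X :=
  [ffun S : {set 'I_N} => \sum_(A : {set 'I_N} | A \subset S)
     shuffle_sign A (S :\: A) *: m (a A) (b (S :\: A))].

Definition wedge_real (V : lmodType R) (a : form N V) (b : form N R^o) :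
    form N V :=
  wedge (fun (v : V) (r : R^o) => (r : R) *: v) a b.

Definition form1 : form N R^o :=
  [ffun S : {set 'I_N} => ((S == finset.set0)%:R : R^o)].

Definition wedge_pow (a : form N R^o) (k : nat) : form N R^o :=
  iter k (wedge_real a) form1.

(* *dx_A = shuffle_sign A (~: A) *: dx_(~: A), for the flat metric and the
   orientation dx_1 /\ ... /\ dx_N. *)
Definition hodge (V : lmodType R) (a : form N V) : form N V :=
  [ffun S : {set 'I_N} => shuffle_sign (~: S) S *: a (~: S)].

(* Coordinates are numbered from 1: for 1 <= p <= N, idx p is the singleton of
   the (p-1)-st element of 'I_N. *)
Definition idx (p : nat) : {set 'I_N} := [set i : 'I_N | i.+1 == p].

Definition dx (p : nat) : form N R^o :=
  [ffun S : {set 'I_N} => ((S == idx p)%:R : R^o)].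

Definition dx2 (p q : nat) : form N R^o := wedge_real (dx p) (dx q).

Definition tensor (V : lmodType R) (a : form N R^o) (v : V) : form N V :=
  [ffun S : {set 'I_N} => (a S : R) *: v].

Definition partial (V : normedModType R) (h : 'rV[R]_N -> V) (i : 'I_N)
    (x : 'rV[R]_N) : V :=
  'D_(delta_mx 0 i) h x.

Definition ext_d (V : normedModType R) (a : 'rV[R]_N -> form N V)
    (x : 'rV[R]_N) : form N V :=
  [ffun S : {set 'I_N} => \sum_(i in S)
     shuffle_sign [set i] (S :\ i) *: partial (fun y => a y (S :\ i)) i x].

Definition df (f : 'rV[R]_N -> R) (x : 'rV[R]_N) : form N R^o :=
  \sum_(i < N) partial (f : 'rV[R]_N -> R^o) i x *: dx i.+1.

Fixpoint class_C (k : nat) (U : set 'rV[R]_N) (f : 'rV[R]_N -> R) : Prop :=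
  (forall x, U x -> {for x, continuous f}) /\
  if k is k'.+1 then
    forall i : 'I_N,
      (forall x, U x -> derivable (f : 'rV[R]_N -> R^o) x (delta_mx 0 i)) /\
      class_C k' U (partial (f : 'rV[R]_N -> R^o) i)
  else True.

End ExteriorAlgebra.

Arguments idx {N} p.
Arguments dx {R N} p.
Arguments dx2 {R N} p q.

Section Quaternionic.
Variables (R : realType) (n : nat).
Local Notation N := (4 * n)%N.

(* Only the values of a on singletons are used: the operators J act on
   1-forms. *)
Definition J1 (a : form N R^o) : form N R^o :=
  \sum_(j < n) (- a (idx (4 * j + 2)) *: dx (4 * j + 1)
                + a (idx (4 * j + 1)) *: dx (4 * j + 2)
                - a (idx (4 * j + 4)) *: dx (4 * j + 3)
                + a (idx (4 * j + 3)) *: dx (4 * j + 4)).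

Definition J2 (a : form N R^o) : form N R^o :=
  \sum_(j < n) (- a (idx (4 * j + 3)) *: dx (4 * j + 1)
                + a (idx (4 * j + 4)) *: dx (4 * j + 2)
                + a (idx (4 * j + 1)) *: dx (4 * j + 3)
                - a (idx (4 * j + 2)) *: dx (4 * j + 4)).

Definition J3 (a : form N R^o) : form N R^o :=
  \sum_(j < n) (- a (idx (4 * j + 4)) *: dx (4 * j + 1)
                - a (idx (4 * j + 3)) *: dx (4 * j + 2)
                + a (idx (4 * j + 2)) *: dx (4 * j + 3)
                + a (idx (4 * j + 1)) *: dx (4 * j + 4)).

Definition J (i : 'I_3) (a : form N R^o) : form N R^o :=
  [:: J1 a; J2 a; J3 a]`_i.

Definition sigma1 : form N R^o :=
  \sum_(j < n) (dx2 (4 * j + 1) (4 * j + 2) + dx2 (4 * j + 3) (4 * j + 4)).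
Definition sigma2 : form N R^o :=
  \sum_(j < n) (dx2 (4 * j + 1) (4 * j + 3) + dx2 (4 * j + 4) (4 * j + 2)).
Definition sigma3 : form N R^o :=
  \sum_(j < n) (dx2 (4 * j + 1) (4 * j + 4) + dx2 (4 * j + 2) (4 * j + 3)).

Definition Sigma : form N R^o :=
  2^-1 *: (wedge_pow sigma1 2 + wedge_pow sigma2 2 + wedge_pow sigma3 2).

Definition c1 : R := - ((2 * n - 1)`!%:R / 2 ^+ (n - 1)).

End Quaternionic.

Section LieAlgebra.
Variable R : realType.

Definition finite_dimensional (g : lmodType R) : Prop :=
  exists (m : nat) (b : 'I_m -> g),
    forall v, exists c : 'I_m -> R, v = \sum_(i < m) c i *: b i.

Record lie_bracket (g : lmodType R) (br : g -> g -> g) : Prop := {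
  lie_linear_l : forall y, linear (br^~ y);
  lie_linear_r : forall x, linear (br x);
  lie_alternating : forall x, br x x = 0;
  lie_jacobi : forall x y z,
    br x (br y z) + br y (br z x) + br z (br x y) = 0
}.

(* l is the derivative at s of a function defined on I only; it is one-sided
   when s is an endpoint of I. *)
Definition has_derivative_on (g : normedModType R) (I : interval R)
    (t : R -> g) (s : R) (l : g) : Prop :=
  ((fun u => (u - s)^-1 *: (t u - t s)) @ within [set` I] s^' --> l)%classic.

(* The cyclic permutations of (123) are the triples (i, i+1, i+2) mod 3. *)
Definition nahm (g : normedModType R) (br : g -> g -> g) (I : interval R)
    (T : 'I_3 -> R -> g) : Prop :=
  forall (i : 'I_3) (s : R), s \in I ->
    has_derivative_on I (T i) s (br (T (ordS i) s) (T (ordS (ordS i)) s)).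

End LieAlgebra.

Section Connection.
Variables (R : realType) (n : nat).
Local Notation N := (4 * n)%N.

(* A connection on the trivial principal K-bundle over an open subset of R^N is
   a 1-form with values in the Lie algebra of K. *)
Definition curvature (g : normedModType R) (br : g -> g -> g)
    (A : 'rV[R]_N -> form N g) (x : 'rV[R]_N) : form N g :=
  ext_d A x + 2^-1 *: wedge br (A x) (A x).

Definition anti_self_dual (g : normedModType R) (br : g -> g -> g)
    (U : set 'rV[R]_N) (A : 'rV[R]_N -> form N g) : Prop :=
  forall x, U x ->
    wedge_real (curvature br A x) (wedge_pow (Sigma R n) (n - 1))
    = c1 R n *: hodge (curvature br A x).

Definition omega (g : normedModType R) (f : 'rV[R]_N -> R)
    (T : 'I_3 -> R -> g) (x : 'rV[R]_N) : form N g :=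
  \sum_(i < 3) tensor (J i (df f x)) (T i (f x)).

Definition dJdf (f : 'rV[R]_N -> R) (i : 'I_3) (x : 'rV[R]_N) : form N R^o :=
  ext_d (V := R^o) (fun y => J i (df f y)) x.

End Connection.

(* Main.v *)
Require Import Defs.
From HB Require Import structures.
From mathcomp Require Import all_boot all_order all_algebra.
From mathcomp Require Import all_classical all_reals all_analysis.
From mathcomp Require Import ring lra zify.
Import Order.TTheory GRing.Theory Num.Theory.
Import numFieldNormedType.Exports.
Local Open Scope ring_scope.
Set Implicit Arguments.
Unset Strict Implicit.
Unset Printing Implicit Defensive.

(** Fix a point x with T(f(x)) != 0.  By Nahm's equations the curvature of
    -omega at x is

      - sum_i T_i(f) d(J^i df)
      + sum_i T_i'(f) (J^j df /\ J^k df - df /\ J^i df),   (ijk) cyclic.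

    Every two-form of the second sum is anti-self-dual, whatever the covector
    df is, so the matter is when sum_i T_i(f) d(J^i df) is anti-self-dual.

    Let S_i be the matrix of J^i on row vectors, which is also the coefficient
    matrix of sigma_i; the S_i satisfy the quaternion relations.  For a matrix
    M put F(M) = sum_pq M_pq dx_p /\ dx_q ([twoform]).  If H is the Hessian
    of f, which is symmetric ([hessian_sym]), then d(J^i df) = F(H S_i).  The
    defect F(M) /\ Sigma^(n-1) - c_1 * F(M) vanishes if and only if the matrix

      sum_i (tr(M^t S_i) S_i + S_i (M - M^t) S_i) + 3 (M - M^t)

    does ([asd_op_twoform_pair]), and for M = H S_i this matrix is K S_i with
    K = tr(H) + 2 (H - sum_j S_j H S_j), a symmetric matrix which commutes
    with the S_j ([asd_defect_sym]).  Thus sum_i T_i(f) d(J^i df) is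
    anti-self-dual if and only if sum_i T_i K S_i = 0.  Right multiplication by
    S_j and left multiplication by K isolate the diagonal of K^2, and T != 0
    then gives K = 0 ([factor_eq0]): the three equations on f.

    The formula for the defect says that * Sigma^(n-1) is a multiple of Sigma:
    the top coefficient of dx_p dx_q dx_r dx_s Sigma^(n-1) is
    (2n-1)!/(3 * 2^(n-1)) times the coefficient of dx_p dx_q dx_r dx_s in Sigma
    ([berezin_quartic]).  Both sides alternate in (p, q, r, s), so the indices
    may be taken increasing, and a parity argument leaves the case where they
    lie in one quaternionic line and the case where they lie two by two in two
    lines.  The computation takes place in the commutative algebra of even
    forms and adds the lines one at a time: if u_i is the i-th Kahler form of
    the lines already present, and s_i and v are the Kahler forms and the
    volume form of the new line, then Sigma becomes Sigma + sum_i u_i s_i + 3 v,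
    and s_i s_j = 2 delta_ij v truncates the powers of the added terms
    ([fundamental_cons_exp]).

    Finally T(f(x)) != 0 for all x in U because Nahm's equations are an
    ordinary differential equation with locally Lipschitz right-hand side: a
    solution with a zero vanishes identically ([nahm_vanishing]).  The proof is
    a Gronwall estimate on the sum of the squares of the coordinates of T. *)

(** * Signs of shuffles *)
Section ShuffleSign.
Variables (R : realType) (N : nat).
Implicit Types A B C : {set 'I_N}.
Local Notation sgn := (@shuffle_sign R N).

Definition inversions A B : nat :=
  (\sum_(i in A) \sum_(j in B) (j < i))%N.

Lemma shuffle_signE A B : sgn A B = (-1) ^+ inversions A B.
Proof.
rewrite /shuffle_sign /inversions; congr (_ ^+ _).
rewrite -sum1_card big_mkcond /= pair_big /= big_mkcond [RHS]big_mkcond /=.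
apply: eq_bigr => -[i j] _ /=; rewrite inE /= .
by case: (i \in A); case: (j \in B); case: (j < i)%N.
Qed.

Lemma sum_setU A B (F : 'I_N -> nat) : [disjoint A & B] ->
  (\sum_(i in A :|: B) F i = \sum_(i in A) F i + \sum_(i in B) F i)%N.
Proof.
move=> dAB; rewrite -bigU //; apply: eq_bigl => i.
by rewrite finset.in_setU.
Qed.

(** Inversions between A and C are counted element by element, so the sign is
    multiplicative in each argument; associativity of the wedge product is this
    cocycle identity. *)
Lemma shuffle_signUl A B C : [disjoint A & B] ->
  sgn (A :|: B) C = sgn A C * sgn B C.
Proof. by move=> dAB; rewrite !shuffle_signE -exprD /inversions sum_setU. Qed.

Lemma shuffle_signUr A B C : [disjoint B & C] ->
  sgn A (B :|: C) = sgn A B * sgn A C.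
Proof.
move=> dBC; rewrite !shuffle_signE -exprD /inversions -big_split /=.
by congr (_ ^+ _); apply: eq_bigr => i _; rewrite sum_setU.
Qed.

Lemma shuffle_sign0l A : sgn finset.set0 A = 1.
Proof. by rewrite shuffle_signE /inversions big_set0. Qed.

Lemma shuffle_sign0r A : sgn A finset.set0 = 1.
Proof.
by rewrite shuffle_signE /inversions big1 // => i _; rewrite big_set0.
Qed.

Lemma shuffle_sign_sqr A B : sgn A B * sgn A B = 1.
Proof. by rewrite shuffle_signE -expr2 sqrr_sign. Qed.

(** Each pair in A x B is an inversion either for (A, B) or for (B, A). *)
Lemma shuffle_signC A B : [disjoint A & B] ->
  sgn B A = (-1) ^+ (#|A| * #|B|)%N * sgn A B.
Proof.
move=> dAB.
suff E : (inversions A B + inversions B A = #|A| * #|B|)%N.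
  by rewrite !shuffle_signE -E exprD mulrAC -expr2 sqrr_sign mul1r.
rewrite /inversions [X in (_ + X)%N]exchange_big /= -big_split /=.
rewrite -sum_nat_const; apply: eq_bigr => i iA.
rewrite -big_split /= -sum1_card; apply: eq_bigr => j jB.
case: ltngtP => //= /val_inj ij.
by have := disjointFr dAB iA; rewrite -ij jB.
Qed.

End ShuffleSign.

(** * The exterior algebra *)
Section Wedge.
Variables (R : realType) (N : nat).
Implicit Types A B C S : {set 'I_N}.
Local Notation form := (Defs.form N R^o).
Local Notation sgn := (@shuffle_sign R N).

Lemma wedge_realE (a b : form) S : wedge_real a b S =
  \sum_(A : {set 'I_N} | A \subset S) sgn A (S :\: A) * (a A * b (S :\: A)).
Proof.
rewrite ffunE; apply: eq_bigr => A _.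
by rewrite [in LHS]/GRing.scale /= [X in _ * X]mulrC.
Qed.

Lemma wedge_realA : associative (@wedge_real R N R^o).
Proof.
move=> a b c; apply/ffunP => S; rewrite !wedge_realE.
under eq_bigr => B _ do rewrite wedge_realE mulr_sumr mulr_sumr.
under [RHS]eq_bigr => A _ do rewrite wedge_realE mulr_suml mulr_sumr.
rewrite [RHS](exchange_big_dep (fun B : {set 'I_N} => B \subset S)) /=; last first.
  by move=> A B AS BA; exact: fintype.subset_trans BA AS.
apply: eq_bigr => B BS.
rewrite [RHS](reindex_onto (fun C => B :|: C) (fun A => A :\: B)) /=; last first.
  move=> A /andP[_ BA]; apply/setP => i; rewrite !finset.in_setU finset.in_setD.
  by case: (boolP (i \in B)) => //= iB; rewrite (fintype.subsetP BA).
apply: eq_big => [C|C].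
  rewrite finset.subUset BS finset.subsetUl andbT /= finset.setDUl finset.setDv finset.set0U.
  rewrite finset.subsetD; congr (_ && _).
  apply/idP/eqP => [d|<-].
    by apply/finset.setDidPl.
  by rewrite -setI_eq0 finset.setIDAC finset.setDIl finset.setDv finset.setI0.
rewrite finset.subsetD => /andP[CS dCB].
have -> : (B :|: C) :\: B = C.
  rewrite finset.setDUl finset.setDv finset.set0U; exact/finset.setDidPl.
rewrite -finset.setDDl.
have dC : [disjoint C & S :\: B :\: C].
  rewrite -setI_eq0; apply/eqP/setP => i; rewrite !inE.
  by case: (i \in C) => //=.
have SB : S :\: B = C :|: (S :\: B :\: C).
  apply/setP => i; rewrite !inE; case: (boolP (i \in C)) => //= iC.
  by rewrite (fintype.subsetP CS _ iC) (disjointFr dCB iC).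
rewrite {1}SB shuffle_signUr // shuffle_signUl; last by rewrite disjoint_sym.
by ring.
Qed.

Lemma wedge_real1l : left_id (form1 R N) (@wedge_real R N R^o).
Proof.
move=> a; apply/ffunP => S; rewrite wedge_realE (bigD1 finset.set0) ?finset.sub0set //=.
rewrite shuffle_sign0l finset.setD0 ffunE eqxx !mul1r big1 ?addr0 // => A.
by case/andP => _ /negbTE A0; rewrite ffunE A0 mul0r mulr0.
Qed.

Lemma wedge_real1r : right_id (form1 R N) (@wedge_real R N R^o).
Proof.
move=> a; apply/ffunP => S; rewrite wedge_realE (bigD1 S) //=.
rewrite finset.setDv shuffle_sign0r ffunE eqxx mulr1 mul1r.
rewrite big1 ?addr0 // => A /andP[AS AneS].
rewrite ffunE (_ : S :\: A == finset.set0 = false) ?mulr0 //.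
apply: contra_neqF AneS; rewrite finset.setD_eq0 => SA.
by apply/eqP; rewrite finset.eqEsubset AS SA.
Qed.

Lemma wedge_realDl : left_distributive (@wedge_real R N R^o) +%R.
Proof.
move=> a b c; apply/ffunP => S; rewrite [RHS]ffunE !wedge_realE -big_split /=.
by apply: eq_bigr => A _; rewrite ffunE; ring.
Qed.

Lemma wedge_realZl (k : R) (a b : form) :
  wedge_real (k *: a) b = k *: wedge_real a b.
Proof.
apply/ffunP => S; rewrite [RHS]ffunE [in RHS]wedge_realE [LHS]wedge_realE /GRing.scale /= mulr_sumr.
by apply: eq_bigr => A _; rewrite ffunE /GRing.scale /=; ring.
Qed.

Lemma wedge_realZr (k : R) (a b : form) :
  wedge_real a (k *: b) = k *: wedge_real a b.
Proof.
apply/ffunP => S; rewrite [RHS]ffunE [in RHS]wedge_realE [LHS]wedge_realE /GRing.scale /= mulr_sumr.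
by apply: eq_bigr => A _; rewrite ffunE /GRing.scale /=; ring.
Qed.

End Wedge.

(** * The commutative algebra of even forms *)
Section Even.
Variables (R : realType) (N : nat).
Implicit Types A B C S : {set 'I_N}.
Local Notation form := (Defs.form N R^o).
Local Notation sgn := (@shuffle_sign R N).

Definition even_form (a : form) : bool :=
  [forall S : {set 'I_N}, odd #|S| ==> (a S == 0)].

Lemma even_formP (a : form) :
  reflect (forall S, odd #|S| -> a S = 0) (even_form a).
Proof.
apply: (iffP forallP) => [h S oS|h S].
  by apply/eqP; move/implyP : (h S); exact.
by apply/implyP => oS; rewrite h.
Qed.

Lemma even_submod_closed : GRing.submod_closed even_form.
Proof.
split=> [|k a b /even_formP ea /even_formP eb]; apply/even_formP => S oS.
  by rewrite ffunE.
by rewrite !ffunE ea // eb // scaler0 addr0.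
Qed.
HB.instance Definition _ := GRing.isSubmodClosed.Build R form even_form even_submod_closed.

(** Forms supported on sets of even cardinal form a commutative ring, in which
    polynomial identities can be normalized; this is why products of one-forms
    are taken two by two below. *)
Record evenform := EvenForm { even_val :> form; _ : even_form even_val }.
HB.instance Definition _ := [isSub for even_val].
HB.instance Definition _ := [Choice of evenform by <:].
HB.instance Definition _ := [SubChoice_isSubLmodule of evenform by <:].

Lemma card_setD_odd S A : A \subset S -> odd #|S| = odd #|A| (+) odd #|S :\: A|.
Proof. by move=> AS; rewrite -(cardsID A S) (finset.setIidPr AS) oddD. Qed.

Lemma even_wedge (a b : evenform) : even_form (wedge_real a b).
Proof.
case: a b => a ea [b eb] /=; move/even_formP: ea => ea; move/even_formP: eb => eb.
apply/even_formP => S oS; rewrite wedge_realE big1 // => A AS.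
move: oS; rewrite (card_setD_odd AS).
case: (boolP (odd #|A|)) => [oA _|_ /= oB]; first by rewrite ea // mul0r mulr0.
by rewrite eb // !mulr0.
Qed.

Lemma even_one : even_form (form1 R N).
Proof.
apply/even_formP => S oS; rewrite ffunE.
by case: eqP oS => // ->; rewrite cards0.
Qed.

Definition even_mul (a b : evenform) : evenform := EvenForm (even_wedge a b).

Lemma even_mulA : associative even_mul.
Proof. by move=> a b c; apply/val_inj/wedge_realA. Qed.

Lemma even_mul1l : left_id (EvenForm even_one) even_mul.
Proof. by move=> a; apply/val_inj/wedge_real1l. Qed.

Lemma even_mulDl : left_distributive even_mul +%R.
Proof. by move=> a b c; apply/val_inj/wedge_realDl. Qed.

(** Reindex the subsets of S by complementation: the sign changes by
    (-1)^(|A| |S - A|), which is 1 as soon as the coefficient at A is nonzero. *)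
Lemma even_mulC : commutative even_mul.
Proof.
move=> [a ea] [b eb]; apply/val_inj/ffunP => S /=; rewrite !wedge_realE.
rewrite (reindex_onto (fun A => S :\: A) (fun A => S :\: A)) /=; last first.
  by move=> A AS; rewrite finset.setDDr finset.setDv finset.set0U; apply/finset.setIidPr.
apply: eq_big => [A|A /andP[_ /eqP E]].
  rewrite finset.subsetDl /= finset.setDDr finset.setDv finset.set0U.
  exact/eqP/finset.setIidPr.
rewrite E.
have dA : [disjoint A & S :\: A].
  by rewrite -setI_eq0; apply/eqP/setP => i; rewrite !inE; case: (i \in A).
case: (boolP (odd #|A|)) => oA.
  by move/even_formP: eb => ->; rewrite // !(mulr0, mul0r).
rewrite (shuffle_signC _ dA) -signr_odd oddM (negbTE oA) mul1r.
by rewrite [a _ * _]mulrC.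
Qed.

Lemma even_one_neq0 : EvenForm even_one != 0.
Proof.
apply/eqP => /(congr1 (fun a : evenform => even_val a finset.set0)) /eqP.
by rewrite !ffunE eqxx /= oner_eq0.
Qed.

HB.instance Definition _ := GRing.Zmodule_isComNzRing.Build evenform
  even_mulA even_mulC even_mul1l even_mulDl even_one_neq0.

Lemma even_scaleAl (k : R) (a b : evenform) : k *: (a * b) = k *: a * b.
Proof. by apply/val_inj; rewrite /= wedge_realZl. Qed.

HB.instance Definition _ := GRing.Lmodule_isLalgebra.Build R evenform even_scaleAl.
HB.instance Definition _ := GRing.Lalgebra_isComAlgebra.Build R evenform.

Lemma even_valM (a b : evenform) : even_val (a * b) = wedge_real (even_val a) (even_val b).
Proof. by []. Qed.

Lemma even_valX (a : evenform) k : even_val (a ^+ k) = wedge_pow (even_val a) k.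
Proof. by elim: k => [//|k IH]; rewrite exprS even_valM IH. Qed.

End Even.

(** * Powers of the fundamental form, one quaternionic line at a time *)

(** The hypotheses give y^3 = 4 x y v = 0, so that the expansion stops after the
    square of y, whose contribution is again a multiple of v. *)
Lemma expr_add_nilp (A : comNzRingType) (x y v : A) (m : nat) :
  y * y = x * v * 4 -> y * v = 0 -> v * v = 0 ->
  (x + y + v * 3) ^+ m.+1
  = x ^+ m.+1 + m.+1%:R * x ^+ m * y + (m.+1 * (2 * m + 3))%:R * x ^+ m * v.
Proof.
move=> yy yv vv; elim: m => [|m IH]; first by rewrite !expr1 !expr0; ring.
rewrite exprS IH (exprS x m.+1) (exprS x m); set z := x ^+ m.
transitivity (x * (x * z) + m.+2%:R * (x * z) * y + (m.+2 * (2 * m.+1 + 3))%:R * (x * z) * v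
   + m.+1%:R * z * (y * y - x * v * 4)
   + (m.+1 * 3 + m.+1 * (2 * m + 3))%:R * z * (y * v)
   + (3 * (m.+1 * (2 * m + 3)))%:R * z * (v * v)).
  ring.
by rewrite yy yv vv subrr !mulr0 !addr0.
Qed.

(** For a family of quaternionic lines indexed by J, [s i a] stands for the i-th
    Kahler form of the line a, [v a] for its volume form, and [t] for 1/3.  The
    relations below are all that the powers of Sigma depend on. *)
Section BlockAlgebra.
Variables (A : comNzRingType) (t : A) (J : Type).
Variables (s : 'I_3 -> J -> A) (v : J -> A).
Hypothesis t3 : t * 3 = 1.
Hypothesis ss : forall i j a, s i a * s j a = (i == j)%:R * 2 * v a.
Hypothesis sv : forall i a, s i a * v a = 0.
Hypothesis vv : forall a, v a * v a = 0.
Implicit Types (r : seq J) (i j : 'I_3).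

Definition kahler i r : A := \sum_(a <- r) s i a.
Definition volume r : A := \prod_(a <- r) v a.
Definition cross r (b : J) : A := \sum_(i < 3) kahler i r * s i b.
(** This is Sigma for the lines of the list; the definition by recursion avoids
    the factor 1/2, see [fundamentalD]. *)
Fixpoint fundamental r : A :=
  if r is a :: r' then fundamental r' + cross r' a + v a * 3 else 0.
(** This is (2k+1)!/2^k, see [top_coef_fact]. *)
Definition top_coef (k : nat) : nat := (\prod_(j < k) (j.+1 * (2 * j + 3)))%N.

Local Notation u := kahler.
Local Notation V := volume.
Local Notation X := fundamental.

Lemma kahler_cons i a r : u i (a :: r) = u i r + s i a.
Proof. by rewrite /kahler big_cons addrC. Qed.

Lemma volume_cons a r : V (a :: r) = v a * V r.
Proof. by rewrite /volume big_cons. Qed.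

Lemma top_coefS k : top_coef k.+1 = (top_coef k * (k.+1 * (2 * k + 3)))%N.
Proof. by rewrite /top_coef big_ord_recr. Qed.

Lemma cross_s r a i : cross r a * s i a = u i r * v a * 2.
Proof.
rewrite /cross mulr_suml (bigD1 i) //= big1 ?addr0 => [|j /negbTE ji].
  by rewrite -mulrA ss eqxx mul1r; ring.
by rewrite -mulrA ss ji !mul0r mulr0.
Qed.

Lemma cross_v r a : cross r a * v a = 0.
Proof. by rewrite /cross mulr_suml big1 // => i _; rewrite -mulrA sv mulr0. Qed.

Lemma fundamentalD r : X r * 2 = \sum_(i < 3) u i r * u i r.
Proof.
elim: r => [|a r IH] /=.
  by rewrite mul0r big1 // => i _; rewrite /kahler big_nil mul0r.
rewrite !mulrDl IH.
under [RHS]eq_bigr => i _ do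
  rewrite kahler_cons mulrDl !mulrDr ss eqxx (mulrC (s i a)) addrACA addrA -addrA.
rewrite 2!big_split /= !big_split /= -/(cross r a) sumr_const card_ord.
ring.
Qed.

Lemma cross_cross r a : cross r a * cross r a = X r * v a * 4.
Proof.
transitivity (X r * 2 * v a * 2); last by ring.
rewrite fundamentalD {2}/cross mulr_sumr !mulr_suml; apply: eq_bigr => i _.
by rewrite mulrCA cross_s; ring.
Qed.

Lemma fundamental_cons_exp r a m : X (a :: r) ^+ m.+1
  = X r ^+ m.+1 + m.+1%:R * X r ^+ m * cross r a
    + (m.+1 * (2 * m + 3))%:R * X r ^+ m * v a.
Proof. by apply: expr_add_nilp; [exact: cross_cross|exact: cross_v|exact: vv]. Qed.

(** Each term of u is a Kahler form of a line whose volume form is a factor of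
    V, and s_i v = 0. *)
Lemma volume_kahler i r : V r * u i r = 0.
Proof.
elim: r => [|a r IH]; first by rewrite /kahler big_nil mulr0.
rewrite volume_cons kahler_cons.
transitivity (v a * (V r * u i r) + s i a * v a * V r); first by ring.
by rewrite IH sv mulr0 mul0r addr0.
Qed.

Lemma volume_fundamental r : V r * X r = 0.
Proof.
elim: r => [|a r IH]; first by rewrite mulr0.
rewrite volume_cons /=.
transitivity (v a * (V r * X r) + V r * (cross r a * v a) + V r * 3 * (v a * v a)).
  by ring.
by rewrite IH cross_v vv !mulr0 !addr0.
Qed.

Lemma fundamental_top r :
  X r ^+ size r = (top_coef (size r))%:R * V r.
Proof.
elim: r => [|a r IH]; first by rewrite expr0 /top_coef /volume big_ord0 big_nil mulr1.
rewrite [size _]/= fundamental_cons_exp exprS IH top_coefS volume_cons.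
rewrite {1}/cross mulr_sumr big1 => [|i _].
  transitivity ((top_coef (size r))%:R * (V r * X r)
     + (top_coef (size r) * ((size r).+1 * (2 * size r + 3)))%:R * (v a * V r)).
    by ring.
  by rewrite volume_fundamental mulr0 add0r.
transitivity ((size r).+1%:R * (top_coef (size r))%:R * (V r * u i r) * s i a).
  by ring.
by rewrite volume_kahler mulr0 mul0r.
Qed.

(** For k lines, Sigma^(k-1) u_i u_j is a top form; it vanishes for i != j and
    does not depend on i = j.  As 2 Sigma = sum_i u_i^2, it is two thirds of
    Sigma^k.  The induction uses that Sigma^k u_i = 0 and Sigma^(k-1) u_i u_j u_l
    = 0 by degree. *)
Lemma fundamental_exp_kahler2 a r i j : let k := size r in
  X (a :: r) ^+ k * (u i (a :: r) * u j (a :: r))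
  = (i == j)%:R * (t * 2) * (top_coef k.+1)%:R * V (a :: r).
Proof.
move=> k; rewrite {}/k; set d := (i == j)%:R.
have ssd a0 : s i a0 * s j a0 = d * 2 * v a0 by exact: ss.
elim: r a => [|b r IH] a.
  rewrite expr0 mul1r /u !big_seq1 ssd volume_cons /volume big_nil.
  rewrite top_coefS /top_coef big_ord0.
  transitivity (d * 2 * v a * (t * 3)); last by rewrite [size _]/=; ring.
  by rewrite t3 mulr1.
move: IH => /(_ b); set k := size r.
have [r' sz ->] : exists2 r', size r' = k.+1 & b :: r = r' by exists (b :: r).
rewrite sz fundamental_cons_exp; set z := X r' ^+ k => IH.
have top w : V r' * w = 0 -> z * X r' * w = 0.
  by move=> h; rewrite -exprSr -sz fundamental_top -mulrA h mulr0.
rewrite !kahler_cons volume_cons top_coefS.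
set ui := u i r'; set uj := u j r'.
have e1 : z * X r' * ui = 0 by apply/top/volume_kahler.
have e2 : z * X r' * uj = 0 by apply/top/volume_kahler.
have e3 : z * (ui * uj) * cross r' a = 0.
  rewrite IH /cross mulr_sumr big1 // => l _.
  by rewrite mulrA -[_ * V r' * _]mulrA volume_kahler mulr0 mul0r.
have e4 : z * X r' = (top_coef k.+1)%:R * V r'.
  by rewrite -exprSr -sz fundamental_top.
have ci := cross_s r' a i; have cj := cross_s r' a j.
rewrite exprSr -/z.
transitivity (z * X r' * ui * (uj + s j a) + z * X r' * uj * s i a
  + z * X r' * (s i a * s j a)
  + k.+1%:R * (z * (ui * uj) * cross r' a)
  + k.+1%:R * z * (cross r' a * s j a * ui + cross r' a * s i a * uj)
  + k.+1%:R * z * (cross r' a * s i a * s j a)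
  + (k.+1 * (2 * k + 3))%:R * (z * (ui * uj) * v a)
  + (k.+1 * (2 * k + 3))%:R * z * (s i a * v a) * (uj + s j a)
  + (k.+1 * (2 * k + 3))%:R * z * (s j a * v a) * ui).
  by ring.
rewrite e1 e2 e3 ci cj !sv ssd e4 !(mulr0, mul0r, addr0, add0r).
transitivity (d * 2 * (top_coef k.+1)%:R * V r' * v a
  + (k.+1 * (2 * k + 3) + k.+1 * 4)%:R * (z * (ui * uj)) * v a
  + k.+1%:R * z * ui * 2 * (s j a * v a)); first by rewrite -/ui -/uj; ring.
rewrite IH sv !mulr0 addr0.
transitivity (d * 2 * (top_coef k.+1)%:R * V r' * v a * (t * 3)
  + (k.+1 * (2 * k + 3) + k.+1 * 4)%:R
    * (d * (t * 2) * (top_coef k.+1)%:R * V r') * v a).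
  by rewrite t3 mulr1.
by ring.
Qed.

Lemma vertical_fundamental_exp a r m : v a * X (a :: r) ^+ m = v a * X r ^+ m.
Proof.
case: m => [//|m]; rewrite fundamental_cons_exp.
transitivity (v a * X r ^+ m.+1 + m.+1%:R * X r ^+ m * (cross r a * v a)
  + (m.+1 * (2 * m + 3))%:R * X r ^+ m * (v a * v a)); first by ring.
by rewrite cross_v vv !mulr0 !addr0.
Qed.

(** The factors g and h play the role of dx_p dx_q in the line a and dx_r dx_s
    in the line b: they kill the volume form of the line and pair with its
    Kahler forms.  Hence only the terms of Sigma^(k+1) which contain exactly one
    s_i of a and one s_j of b survive in the product with g h; they come either
    from a factor s_i s_j of Sigma or from two factors u_i s_i and u_j s_j. *)
Section TwoBlocks.
Variables (g h : A) (gc hc : 'I_3 -> A) (a b : J).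
Hypothesis gv : g * v a = 0.
Hypothesis hv : h * v b = 0.
Hypothesis gs : forall i, g * s i a = gc i * v a.
Hypothesis hs : forall i, h * s i b = hc i * v b.

Lemma two_blocks_kahler r i :
  h * (X (b :: r) ^+ size r * u i (b :: r))
  = hc i * (t * (2 * size r + 3)%:R * (top_coef (size r))%:R) * V (b :: r).
Proof.
rewrite kahler_cons mulrDr mulrDr.
have -> : h * (X (b :: r) ^+ size r * s i b)
        = hc i * (top_coef (size r))%:R * V (b :: r).
  transitivity (h * s i b * X (b :: r) ^+ size r); first by ring.
  rewrite hs -mulrA vertical_fundamental_exp fundamental_top volume_cons.
  ring.
suff -> : h * (X (b :: r) ^+ size r * u i r)
        = hc i * (t * (2 * size r)%:R * (top_coef (size r))%:R) * V (b :: r).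
  transitivity (hc i * (t * (2 * size r)%:R * (top_coef (size r))%:R) * V (b :: r)
     + hc i * (t * 3) * (top_coef (size r))%:R * V (b :: r)); last by ring.
  by rewrite t3; ring.
case: r => [|c r']; first by rewrite /kahler big_nil [size _]/=; ring.
set k := size r'; set r := c :: r'; rewrite -[size r]/k.+1.
have hcross : h * cross r b = (\sum_(l < 3) u l r * hc l) * v b.
  rewrite /cross mulr_sumr mulr_suml; apply: eq_bigr => l _.
  by rewrite mulrCA hs mulrA.
rewrite fundamental_cons_exp.
transitivity (h * (X r ^+ k.+1 * u i r) + k.+1%:R * (X r ^+ k * u i r) * (h * cross r b)
  + (k.+1 * (2 * k + 3))%:R * X r ^+ k * u i r * (h * v b)); first by ring.
rewrite hv mulr0 addr0 -{1}[k.+1]/(size r) fundamental_top.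
rewrite -(mulrA (top_coef _)%:R) volume_kahler !mulr0 add0r hcross.
rewrite mulrA mulr_sumr (bigD1 i) //= big1 ?addr0 => [|l /negbTE li].
  transitivity (k.+1%:R * (X r ^+ k * (u i r * u i r)) * hc i * v b); first by ring.
  by rewrite fundamental_exp_kahler2 eqxx mul1r (volume_cons b); ring.
transitivity (k.+1%:R * (X r ^+ k * (u i r * u l r)) * hc l); first by ring.
by rewrite fundamental_exp_kahler2 eq_sym li !mul0r mulr0 mul0r.
Qed.

Lemma two_blocks_top r :
  g * h * X (a :: b :: r) ^+ (size r).+1
  = (\sum_(i < 3) gc i * hc i) * t * (top_coef (size r).+1)%:R * V (a :: b :: r).
Proof.
set k := size r; rewrite fundamental_cons_exp.
have gcross : g * cross (b :: r) a = (\sum_(l < 3) u l (b :: r) * gc l) * v a.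
  rewrite /cross mulr_sumr mulr_suml; apply: eq_bigr => l _.
  by rewrite mulrCA gs mulrA.
transitivity (g * (h * X (b :: r) ^+ k.+1)
  + k.+1%:R * (h * X (b :: r) ^+ k) * (g * cross (b :: r) a)
  + (k.+1 * (2 * k + 3))%:R * h * X (b :: r) ^+ k * (g * v a)); first by ring.
rewrite gv mulr0 addr0 -{1}[k.+1]/(size (b :: r)) fundamental_top.
rewrite (_ : h * _ = (h * v b) * ((top_coef (size (b :: r)))%:R * V r)); last first.
  by rewrite (volume_cons b); ring.
rewrite hv mul0r mulr0 add0r gcross.
rewrite mulrA mulr_sumr !mulr_suml; apply: eq_bigr => i _.
transitivity (k.+1%:R * (h * (X (b :: r) ^+ k * u i (b :: r))) * gc i * v a).
  by ring.
rewrite two_blocks_kahler -/k top_coefS (volume_cons a).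
ring.
Qed.

End TwoBlocks.

End BlockAlgebra.

(** * Products of coordinate one-forms and the top coefficient *)
Section TwoForms.
Variables (R : realType) (N : nat).
Implicit Types (A B S : {set 'I_N}) (p q r s i j : 'I_N).
Local Notation form := (Defs.form N R^o).
Local Notation sgn := (@shuffle_sign R N).
Local Notation dx p := (dx (nat_of_ord p).+1 : form).

Lemma idx_ord p : idx p.+1 = [set p] :> {set 'I_N}.
Proof. by apply/setP => i; rewrite !inE eqSS. Qed.

Lemma dxE p S : dx p S = (S == [set p])%:R.
Proof. by rewrite ffunE idx_ord. Qed.

Lemma dx_wedgeE p (b : form) S :
  wedge_real (dx p) b S = (p \in S)%:R * (sgn [set p] (S :\ p) * b (S :\ p)).
Proof.
rewrite wedge_realE; case: (boolP (p \in S)) => pS; last first.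
  rewrite mul0r big1 // => A AS; rewrite dxE.
  case: eqP => [E|_]; last by rewrite mul0r mulr0.
  by move: AS; rewrite E finset.sub1set (negbTE pS).
rewrite (bigD1 [set p]) ?finset.sub1set //= dxE eqxx big1 ?addr0.
  by rewrite !mul1r.
by move=> A /andP[_ /negbTE E]; rewrite dxE E mul0r mulr0.
Qed.

Lemma dx_dxE p q S : wedge_real (dx p) (dx q) S
  = ((p != q) && (S == [set p; q]))%:R * sgn [set p] [set q].
Proof.
rewrite dx_wedgeE dxE.
have -> : (p != q) && (S == [set p; q]) = (p \in S) && (S :\ p == [set q]).
  apply/idP/idP => [/andP[pq /eqP->]|/andP[pS /eqP E]].
    rewrite !inE eqxx /=; apply/eqP/setP => i; rewrite !inE.
    by case: eqP => [->|//]; rewrite (negbTE pq).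
  have : q \in S :\ p by rewrite E inE.
  rewrite !inE eq_sym => /andP[-> _] /=.
  by rewrite -(finset.setD1K pS) E.
case: (p \in S) => /=; last by rewrite !mul0r.
by case: eqP => [->|_]; rewrite ?mulr1 ?mul1r // !mulr0 mul0r.
Qed.

Lemma dx_dxC p q : wedge_real (dx p) (dx q) = - wedge_real (dx q) (dx p).
Proof.
apply/ffunP => S; rewrite [RHS]ffunE !dx_dxE eq_sym finset.setUC.
case: (boolP (q != p)) => [qp|_] /=; last by rewrite !mul0r oppr0.
rewrite (@shuffle_signC _ _ [set q] [set p]) ?cards1 ?expr1; first by ring.
by rewrite disjoints1 inE.
Qed.

Lemma even_dx_dx p q : even_form (wedge_real (dx p) (dx q)).
Proof.
apply/even_formP => S oS; rewrite dx_dxE.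
case: (boolP (p != q)) => [pq|_] /=; last by rewrite mul0r.
by case: eqP oS => [->|_]; [rewrite cards2 pq|rewrite mul0r].
Qed.

Definition dx_pair p q : evenform R N := EvenForm (even_dx_dx p q).
Local Notation w := dx_pair.

Lemma dx_pairC p q : w p q = - w q p.
Proof. exact/val_inj/dx_dxC. Qed.

Lemma dx_pairpp p : w p p = 0.
Proof. by apply/val_inj/ffunP => S; rewrite /= dx_dxE eqxx mul0r ffunE. Qed.

Lemma wedge_realN (a b : form) : wedge_real (- a) b = - wedge_real a b.
Proof. by rewrite -scaleN1r wedge_realZl scaleN1r. Qed.

Lemma wedge_realrN (a b : form) : wedge_real a (- b) = - wedge_real a b.
Proof. by rewrite -scaleN1r wedge_realZr scaleN1r. Qed.

(** Together with [dx_pairC], this is the anticommutation of one-forms, expressed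
    inside the ring of even forms. *)
Lemma dx_pair_swap p q r s : w p q * w r s = - (w p r * w q s).
Proof.
apply/val_inj; rewrite /= -!wedge_realA [wedge_real (dx q) _]wedge_realA.
by rewrite (dx_dxC q r) wedge_realN wedge_realrN -wedge_realA.
Qed.

Lemma dx_pair_mulpp p q r : w p q * w p r = 0.
Proof. by rewrite dx_pair_swap dx_pairpp mul0r oppr0. Qed.

(** The coefficient on dx_1 /\ ... /\ dx_N, that is, the Berezin integral. *)
Definition berezin (a : evenform R N) : R := even_val a finset.setT.

Lemma berezinD a b : berezin (a + b) = berezin a + berezin b.
Proof. by rewrite /berezin ffunE. Qed.

Lemma berezinZ k a : berezin (k *: a) = k * berezin a.
Proof. by rewrite /berezin ffunE. Qed.

Lemma berezin_sum (T : Type) (l : seq T) (P : pred T) (F : T -> evenform R N) :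
  berezin (\sum_(i <- l | P i) F i) = \sum_(i <- l | P i) berezin (F i).
Proof.
elim/big_rec2: _ => [|i x y _ <-]; first by rewrite /berezin ffunE.
exact: berezinD.
Qed.

(** The top coefficient of dx_p dx_q a reads off one coefficient of a, up to a
    sign: equalities between forms of degree N - 2 are tested in this way. *)
Lemma berezin_dx_pair p q (a : evenform R N) : p != q ->
  berezin (w p q * a) = sgn [set p] [set q] * sgn [set p; q] (~: [set p; q])
    * even_val a (~: [set p; q]).
Proof.
move=> pq; rewrite /berezin /= wedge_realE (bigD1 [set p; q]) ?finset.subsetT //=.
rewrite big1 ?addr0 => [|A /andP[_ /negbTE AE]].
  by rewrite dx_dxE pq eqxx mul1r finset.setTD; ring.
by rewrite dx_dxE AE andbF mul0r mul0r mulr0.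
Qed.

Lemma shuffle_sign_lt A B :
  {in A & B, forall i j, (i < j)%N} -> sgn A B = 1.
Proof.
move=> AB; rewrite shuffle_signE (_ : inversions A B = 0)%N //.
apply: big1 => i iA; apply: big1 => j jB.
by rewrite ltnNge (ltnW (AB _ _ iA jB)).
Qed.

(* flip *)
(** The automorphism of the exterior algebra which changes dx_i into -dx_i for
    i in B.  It fixes Sigma when B is a quaternionic line, whence the parity
    argument of [berezin_odd_block]. *)
Definition flip B (a : form) : form := [ffun S : {set 'I_N} => (-1) ^+ #|S :&: B| * a S].

Lemma flip_wedge B (a b : form) :
  flip B (wedge_real a b) = wedge_real (flip B a) (flip B b).
Proof.
apply/ffunP => S; rewrite ffunE !wedge_realE mulr_sumr; apply: eq_bigr => A AS.
rewrite !ffunE.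
have -> : #|S :&: B| = (#|A :&: B| + #|(S :\: A) :&: B|)%N.
  rewrite -(cardsID A (S :&: B)); congr (_ + _)%N.
    by rewrite finset.setIAC (finset.setIidPr AS).
  by rewrite finset.setIDAC.
by rewrite exprD; ring.
Qed.

Lemma even_flip B (a : evenform R N) : even_form (flip B (even_val a)).
Proof.
case: a => a ea /=; apply/even_formP => S oS.
by move/even_formP: ea => ea; rewrite ffunE ea // mulr0.
Qed.

Definition flip_even B (a : evenform R N) : evenform R N := EvenForm (even_flip B a).

Lemma flip_evenM B a b : flip_even B (a * b) = flip_even B a * flip_even B b.
Proof. exact/val_inj/flip_wedge. Qed.

Lemma flip_evenD B a b : flip_even B (a + b) = flip_even B a + flip_even B b.
Proof. by apply/val_inj/ffunP => S; rewrite !ffunE mulrDr. Qed.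

Lemma flip_even0 B : flip_even B 0 = 0.
Proof. by apply/val_inj/ffunP => S; rewrite !ffunE mulr0. Qed.

Lemma flip_even_sum B (T : Type) (l : seq T) (F : T -> evenform R N) :
  flip_even B (\sum_(i <- l) F i) = \sum_(i <- l) flip_even B (F i).
Proof.
by elim/big_rec2: _ => [|i x y _ <-]; [exact: flip_even0|exact: flip_evenD].
Qed.

Lemma flip_evenX B a m : flip_even B (a ^+ m) = flip_even B a ^+ m.
Proof.
elim: m => [|m IH]; last by rewrite !exprS flip_evenM IH.
apply/val_inj/ffunP => S; rewrite !ffunE.
by case: eqP => [->|_]; rewrite ?mulr0 // finset.set0I cards0 mul1r.
Qed.

Lemma flip_even_dx_pair B p q :
  flip_even B (w p q) = (-1) ^+ ((p \in B) + (q \in B)) *: w p q.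
Proof.
apply/val_inj/ffunP => S; rewrite ffunE [RHS]ffunE /= !dx_dxE /GRing.scale /=.
case: (boolP (p != q)) => [pq|_] /=; last by rewrite !mul0r !mulr0.
case: eqP => [->|_]; last by rewrite !mul0r !mulr0.
congr (_ ^+ _ * _); rewrite finset.setIUl cardsU.
have I1 i : #|[set i] :&: B| = (i \in B).
  case: (boolP (i \in B)) => iB.
    by rewrite (finset.setIidPl _) ?cards1 // finset.sub1set.
  by apply/eqP; rewrite cards_eq0 setI_eq0 disjoints1.
rewrite !I1 (_ : _ :&: _ = finset.set0) ?cards0 ?subn0 //.
apply/eqP; rewrite -finset.subset0; apply/fintype.subsetP => i; rewrite !inE.
by case/andP => /andP[/eqP-> _]; rewrite (negbTE pq).
Qed.

Lemma berezin_flip_even B a : berezin (flip_even B a) = (-1) ^+ #|B| * berezin a.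
Proof. by rewrite /berezin ffunE finset.setTI. Qed.

End TwoForms.

(** * Quaternionic lines in R^(4n) *)
Section BlockIndices.
Variable n : nat.

(** Coordinates are written p = 4 j + k, with j the quaternionic line and k the
    position in that line. *)
Definition k0 : 'I_4 := @Ordinal 4 0 isT.
Definition k1 : 'I_4 := @Ordinal 4 1 isT.
Definition k2 : 'I_4 := @Ordinal 4 2 isT.
Definition k3 : 'I_4 := @Ordinal 4 3 isT.

Lemma ord4_ind (P : 'I_4 -> Prop) : P k0 -> P k1 -> P k2 -> P k3 -> forall k, P k.
Proof.
move=> h0 h1 h2 h3 [[|[|[|[|//]]]] hk].
- by rewrite (_ : Ordinal hk = k0) //; exact: val_inj.
- by rewrite (_ : Ordinal hk = k1) //; exact: val_inj.
- by rewrite (_ : Ordinal hk = k2) //; exact: val_inj.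
- by rewrite (_ : Ordinal hk = k3) //; exact: val_inj.
Qed.

Definition unit_i : 'I_3 := @Ordinal 3 0 isT.
Definition unit_j : 'I_3 := @Ordinal 3 1 isT.
Definition unit_k : 'I_3 := @Ordinal 3 2 isT.

Lemma ord3_ind (P : 'I_3 -> Prop) : P unit_i -> P unit_j -> P unit_k -> forall i, P i.
Proof.
move=> h0 h1 h2 [[|[|[|//]]] hk].
- by rewrite (_ : Ordinal hk = unit_i) //; exact: val_inj.
- by rewrite (_ : Ordinal hk = unit_j) //; exact: val_inj.
- by rewrite (_ : Ordinal hk = unit_k) //; exact: val_inj.
Qed.

Lemma pt_subproof (j : 'I_n) (k : 'I_4) : (4 * j + k < 4 * n)%N.
Proof. by case: j => j hj; case: k => k hk /=; lia. Qed.
Definition pt (j : 'I_n) (k : 'I_4) : 'I_(4 * n) := Ordinal (pt_subproof j k).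

Lemma blk_subproof (p : 'I_(4 * n)) : (p %/ 4 < n)%N.
Proof. by case: p => p hp /=; rewrite ltn_divLR // mulnC. Qed.
Definition blk (p : 'I_(4 * n)) : 'I_n := Ordinal (blk_subproof p).
Definition pos (p : 'I_(4 * n)) : 'I_4 := Ordinal (ltn_pmod p (isT : 0 < 4)%N).

Lemma ptK p : pt (blk p) (pos p) = p.
Proof. by apply: val_inj => /=; rewrite mulnC -divn_eq. Qed.

Lemma blk_pt j k : blk (pt j k) = j.
Proof. by apply: val_inj => /=; rewrite mulnC divnMDl // divn_small ?addn0. Qed.

Lemma pos_pt j k : pos (pt j k) = k.
Proof. by apply: val_inj => /=; rewrite mulnC modnMDl modn_small. Qed.

Lemma pt_eq j k j' k' : (pt j k == pt j' k') = (j == j') && (k == k').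
Proof.
apply/eqP/andP => [E|[/eqP-> /eqP->]] //.
by move: (congr1 blk E) (congr1 pos E); rewrite !blk_pt !pos_pt => -> ->.
Qed.

Lemma sum_pt (V : nmodType) (F : 'I_(4 * n) -> V) :
  \sum_p F p = \sum_(j < n) \sum_(k < 4) F (pt j k).
Proof.
rewrite pair_big /= (reindex (fun jk : 'I_n * 'I_4 => pt jk.1 jk.2)); first by [].
apply: onW_bij; exists (fun p => (blk p, pos p)) => [[j k]|p] /=; last exact: ptK.
by rewrite blk_pt pos_pt.
Qed.

(** The structure J^i permutes the four coordinates of a line up to sign: it
    maps dx_k to (-1)^(neg4 i k) dx_(rho4 i k). *)
Definition rho4 (i : 'I_3) (k : 'I_4) : 'I_4 :=
  nth k0 (nth [::] [:: [:: k1; k0; k3; k2]; [:: k2; k3; k0; k1];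
                       [:: k3; k2; k1; k0]] i) k.
Definition neg4 (i : 'I_3) (k : 'I_4) : bool :=
  nth false (nth [::] [:: [:: false; true; false; true];
    [:: false; true; true; false]; [:: false; false; true; true]] i) k.

Definition rho (i : 'I_3) (p : 'I_(4 * n)) := pt (blk p) (rho4 i (pos p)).

End BlockIndices.

(** * Kahler forms of the quaternionic lines *)
Section Blocks.
Variables (R : realType) (n : nat).
Local Notation N := (4 * n)%N.
Local Notation E := (evenform R N).
Implicit Types (a b : 'I_n) (i j : 'I_3) (p q r s : 'I_N).

(** The matrix of J^i on row vectors, which is also the coefficient matrix of
    sigma_i. *)
Definition quat (i : 'I_3) : 'M[R]_N :=
  \matrix_(p, q) ((-1) ^+ neg4 i (pos p) * (q == rho i p)%:R).

Lemma quat_pt i a b k l : quat i (pt a k) (pt b l)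
  = (a == b)%:R * ((-1) ^+ neg4 i k * (l == rho4 i k)%:R).
Proof.
rewrite mxE pos_pt /rho blk_pt pos_pt pt_eq [b == a]eq_sym.
by case: (a == b); rewrite ?mul1r //= !(mul0r, mulr0).
Qed.

Lemma quat_blk i p q : blk p != blk q -> quat i p q = 0.
Proof. by move=> pq; rewrite -(ptK p) -(ptK q) quat_pt (negbTE pq) mul0r. Qed.

(** The Kahler form of a line is the sum of two coordinate planes: dx_0 dx_i, and
    the plane of the two other coordinates, oriented by * (dx_0 dx_i). *)
Definition first_plane i a : E :=
  nth 0 [:: dx_pair R (pt a k0) (pt a k1); dx_pair R (pt a k0) (pt a k2);
            dx_pair R (pt a k0) (pt a k3)] i.
Definition second_plane i a : E :=
  nth 0 [:: dx_pair R (pt a k2) (pt a k3); dx_pair R (pt a k3) (pt a k1);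
            dx_pair R (pt a k1) (pt a k2)] i.
Definition block_sigma i a : E := first_plane i a + second_plane i a.
Definition block_volume a : E := first_plane unit_i a * second_plane unit_i a.

Lemma first_plane_mul i j a : first_plane i a * first_plane j a = 0.
Proof. by elim/ord3_ind: i; elim/ord3_ind: j; exact: dx_pair_mulpp. Qed.

Lemma second_plane_mul i j a : second_plane i a * second_plane j a = 0.
Proof.
have z p q r : dx_pair R p q * dx_pair R q r = 0.
  by rewrite dx_pairC mulNr dx_pair_mulpp oppr0.
have z' p q r : dx_pair R p q * dx_pair R r p = 0.
  by rewrite mulrC; exact: z.
rewrite /second_plane; have zz := @dx_pair_mulpp R N; move: zz z z'.
move: (@dx_pair R N) => w zz z z'; move: (pt a k1) (pt a k2) (pt a k3) => e1 e2 e3.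
by elim/ord3_ind: i; elim/ord3_ind: j; rewrite /= ?zz ?z ?z'.
Qed.

Lemma first_second_plane i j a : first_plane i a * second_plane j a = (i == j)%:R *: block_volume a.
Proof.
have z p q r : dx_pair R p q * dx_pair R q r = 0.
  by rewrite dx_pairC mulNr dx_pair_mulpp oppr0.
have z' p q r : dx_pair R p q * dx_pair R r q = 0.
  by rewrite (dx_pairC _ r) mulrN z oppr0.
have sw := @dx_pair_swap R N; have C := @dx_pairC R N.
rewrite /block_volume /first_plane /second_plane; move: z z' sw C.
move: (@dx_pair R N) => w z z' sw C.
move: (pt a k0) (pt a k1) (pt a k2) (pt a k3) => e0 e1 e2 e3.
elim/ord3_ind: i; elim/ord3_ind: j; rewrite /= ?z ?z' ?scale0r ?scale1r //.
- by rewrite (sw e0 e2) (C e2) mulrN opprK (sw e0 e3) (C e3) mulrN opprK.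
- by rewrite (sw e0 e3) (C e3) mulrN opprK.
Qed.

Lemma second_first_plane i j a : second_plane i a * first_plane j a = (i == j)%:R *: block_volume a.
Proof. by rewrite mulrC first_second_plane eq_sym. Qed.

(** As sigma_i is self-dual on the line, its product with dx_k dx_l is its own
    coefficient on dx_k dx_l. *)
Lemma dx_pair_block_sigma a k l i : dx_pair R (pt a k) (pt a l) * block_sigma i a
  = quat i (pt a k) (pt a l) *: block_volume a.
Proof.
have h1 m : first_plane m a * block_sigma i a = (m == i)%:R *: block_volume a.
  by rewrite mulrDr first_plane_mul add0r first_second_plane.
have h2 m : second_plane m a * block_sigma i a = (m == i)%:R *: block_volume a.
  by rewrite mulrDr second_plane_mul addr0 second_first_plane.
have h01 := h1 unit_i; have h02 := h1 unit_j; have h03 := h1 unit_k.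
have h23 := h2 unit_i; have h31 := h2 unit_j; have h12 := h2 unit_k.
rewrite quat_pt eqxx mul1r.
rewrite /first_plane /second_plane /= in h01 h02 h03 h23 h31 h12.
set sg := block_sigma i a in h01 h02 h03 h23 h31 h12 *.
set vl := block_volume a in h01 h02 h03 h23 h31 h12 *.
clearbody sg vl; clear h1 h2.
have -> : pt a k = nth (pt a k0) [:: pt a k0; pt a k1; pt a k2; pt a k3] k.
  by elim/ord4_ind: k.
have -> : pt a l = nth (pt a k0) [:: pt a k0; pt a k1; pt a k2; pt a k3] l.
  by elim/ord4_ind: l.
move: (pt a k0) (pt a k1) (pt a k2) (pt a k3) h01 h02 h03 h23 h31 h12.
move=> e0 e1 e2 e3 h01 h02 h03 h23 h31 h12.
have sw p q c : dx_pair R q p * sg = c *: vl -> dx_pair R p q * sg = - c *: vl.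
  by move=> h; rewrite dx_pairC mulNr h scaleNr.
have h10 := sw _ _ _ h01; have h20 := sw _ _ _ h02; have h30 := sw _ _ _ h03.
have h32 := sw _ _ _ h23; have h13 := sw _ _ _ h31; have h21 := sw _ _ _ h12.
have hh p : dx_pair R p p * sg = 0 *: vl by rewrite dx_pairpp mul0r scale0r.
clear sw; move: hh h01 h02 h03 h23 h31 h12 h10 h20 h30 h32 h13 h21.
move: (@dx_pair R N) => w hh h01 h02 h03 h23 h31 h12 h10 h20 h30 h32 h13 h21.
have E c d : c = d -> c *: vl = d *: vl by move=> ->.
elim/ord4_ind: k; elim/ord4_ind: l; rewrite [nth _ _ _]/= [X in w _ X]/=;
  rewrite ?(hh, h01, h02, h03, h23, h31, h12, h10, h20, h30, h32, h13, h21);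
  apply: E; clear -i; elim/ord3_ind: i => /=;
  by rewrite ?expr0 ?expr1 ?mul1r ?mulN1r ?mulr1 ?mulr0 ?oppr0.
Qed.

Lemma first_plane_volume m a : first_plane m a * block_volume a = 0.
Proof. by rewrite mulrA first_plane_mul mul0r. Qed.

Lemma second_plane_volume m a : second_plane m a * block_volume a = 0.
Proof. by rewrite mulrCA second_plane_mul mulr0. Qed.

Lemma dx_pair_block_volume a k l : dx_pair R (pt a k) (pt a l) * block_volume a = 0.
Proof.
have h01 := first_plane_volume unit_i a; have h02 := first_plane_volume unit_j a.
have h03 := first_plane_volume unit_k a.
have h23 := second_plane_volume unit_i a; have h31 := second_plane_volume unit_j a.
have h12 := second_plane_volume unit_k a.
rewrite /first_plane /second_plane /= in h01 h02 h03 h23 h31 h12.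
wlog kl : k l / (k <= l)%N => [W|].
  by case: (leqP k l) => [|/ltnW] /W // h; rewrite dx_pairC mulNr h oppr0.
have h13 : dx_pair R (pt a k1) (pt a k3) * block_volume a = 0.
  by rewrite dx_pairC mulNr h31 oppr0.
have hh p : dx_pair R p p * block_volume a = 0 by rewrite dx_pairpp mul0r.
by move: kl; elim/ord4_ind: k; elim/ord4_ind: l => //= _; exact: hh.
Qed.

Lemma block_sigma_volume i a : block_sigma i a * block_volume a = 0.
Proof. by rewrite mulrDl first_plane_volume second_plane_volume addr0. Qed.

Lemma block_volume_sqr a : block_volume a * block_volume a = 0.
Proof. by rewrite {1}/block_volume -mulrA second_plane_volume mulr0. Qed.

Lemma block_sigma_mul i j a : block_sigma i a * block_sigma j a = (i == j)%:R * 2 * block_volume a.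
Proof.
rewrite {1}/block_sigma mulrDl !mulrDr first_plane_mul second_plane_mul first_second_plane.
rewrite second_first_plane add0r addr0 scaler_nat.
by rewrite -mulr_natl; ring.
Qed.

Definition third : E := (3^-1 : R)%:A.

Lemma third3 : third * 3 = 1.
Proof.
by rewrite /third mulr_natr -scaler_nat scalerA mulfV ?scale1r // pnatr_eq0.
Qed.

(** The recursive definition of Sigma agrees with 1/2 sum_i sigma_i^2; in
    particular it does not depend on the order in which lines are added. *)
Lemma fundamentalE (l : seq 'I_n) : fundamental (@block_sigma) block_volume l
  = (2^-1 : R) *: \sum_(i < 3) kahler (@block_sigma) i l * kahler (@block_sigma) i l.
Proof.
rewrite -(fundamentalD block_sigma_mul); set x := fundamental _ _ _.
have -> : x * 2 = (2 : R) *: x by rewrite mulr_natr scaler_nat.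
by rewrite scalerA mulVf ?scale1r // pnatr_eq0.
Qed.

Lemma fundamental_perm (l1 l2 : seq 'I_n) : perm_eq l1 l2 ->
  fundamental (@block_sigma) block_volume l1 = fundamental (@block_sigma) block_volume l2.
Proof.
move=> l12; rewrite !fundamentalE; congr (_ *: _).
by apply: eq_bigr => i _; rewrite /kahler !(perm_big _ l12).
Qed.

Definition even_Sigma : E := fundamental (@block_sigma) block_volume (enum 'I_n).
Definition even_volume : E := volume block_volume (enum 'I_n).

(** The coefficient of dx_p dx_q dx_r dx_s in 1/2 sum_i sigma_i^2, for distinct
    indices. *)
Definition quartic p q r s : R := \sum_(i < 3)
  (quat i p q * quat i r s - quat i p r * quat i q s + quat i p s * quat i q r).

Lemma quatN i p q : quat i q p = - quat i p q.
Proof.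
rewrite -(ptK p) -(ptK q) !quat_pt eq_sym; case: (_ == _); last by rewrite !mul0r oppr0.
by elim/ord3_ind: i; elim/ord4_ind: (pos p); elim/ord4_ind: (pos q);
  rewrite !mul1r /= ?expr0 ?expr1 ?mulN1r ?mul1r ?mulr0 ?opprK ?oppr0.
Qed.

Lemma blk_leq p q : (p <= q)%N -> (blk p <= blk q)%N.
Proof. exact: leq_div2r. Qed.

(** Insertion sort: every quadruple becomes increasing, or acquires two equal
    neighbours, after finitely many exchanges of neighbours. *)
Lemma alternating_ind (D : 'I_N -> 'I_N -> 'I_N -> 'I_N -> R) :
  (forall p q r s, D q p r s = - D p q r s) ->
  (forall p q r s, D p r q s = - D p q r s) ->
  (forall p q r s, D p q s r = - D p q r s) ->
  (forall p q r s, (p < q < r)%N -> (r < s)%N -> D p q r s = 0) ->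
  forall p q r s, D p q r s = 0.
Proof.
move=> s1 s2 s3 D0.
have z1 p r s : D p p r s = 0 by have := s1 p p r s; lra.
have z2 p q s : D p q q s = 0 by have := s2 p q q s; lra.
have z3 p q r : D p q r r = 0 by have := s3 p q r r; lra.
have d1 p q r s : D q p r s = 0 -> D p q r s = 0 by rewrite s1; lra.
have d2 p q r s : D p r q s = 0 -> D p q r s = 0 by rewrite s2; lra.
have d3 p q r s : D p q s r = 0 -> D p q r s = 0 by rewrite s3; lra.
have sort3 p q r s : (p < q)%N -> (q < r)%N -> D p q r s = 0.
  move=> pq qr; case: (ltngtP r s) => [rs|sr|/val_inj->]; last exact: z3.
    by apply: D0; rewrite ?pq.
  apply: d3; case: (ltngtP q s) => [qs|sq|/val_inj->]; last exact: z2.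
    by apply: D0; rewrite ?pq.
  apply: d2; case: (ltngtP p s) => [ps|sp|/val_inj->]; last exact: z1.
    by apply: D0; rewrite ?ps.
  by apply: d1; apply: D0; rewrite ?sp.
have sort2 p q r s : (p < q)%N -> D p q r s = 0.
  move=> pq; case: (ltngtP q r) => [qr|rq|/val_inj->]; last exact: z2.
    exact: sort3.
  apply: d2; case: (ltngtP p r) => [pr|rp|/val_inj->]; last exact: z1.
    exact: sort3.
  by apply: d1; exact: sort3.
move=> p q r s; case: (ltngtP p q) => [pq|qp|/val_inj->]; last exact: z1.
  exact: sort2.
by apply: d1; exact: sort2.
Qed.

Section Flip.
Variable a : 'I_n.
Let B : {set 'I_N} := [set p | blk p == a].

Lemma card_block : ~~ odd #|B|.
Proof.
have -> : #|B| = #|[set: 'I_4]|; last by rewrite cardsT card_ord.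
have inj : injective (pt a) by move=> k l /(congr1 (@pos n)); rewrite !pos_pt.
rewrite -(card_imset _ inj); apply: eq_card => p; rewrite inE.
apply/eqP/finset.imsetP => [<-|[k _ ->]]; last by rewrite blk_pt.
by exists (pos p); rewrite ?inE // ptK.
Qed.

Lemma flip_block_pair b k l :
  flip_even B (dx_pair R (pt b k) (pt b l)) = dx_pair R (pt b k) (pt b l).
Proof. by rewrite flip_even_dx_pair !inE !blk_pt addnn -signr_odd odd_double scale1r. Qed.

Lemma flip_block_sigma i b : flip_even B (block_sigma i b) = block_sigma i b.
Proof.
by rewrite /block_sigma flip_evenD; elim/ord3_ind: i;
  rewrite /first_plane /second_plane /= !flip_block_pair.
Qed.

Lemma flip_block_Sigma : flip_even B even_Sigma = even_Sigma.
Proof.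
rewrite /even_Sigma fundamentalE.
have eZ (k : R) x : flip_even B (k *: x) = k *: flip_even B x.
  by apply/val_inj/ffunP => S; rewrite !ffunE /GRing.scale /=; ring.
rewrite eZ flip_even_sum; congr (_ *: _); apply: eq_bigr => i _; rewrite flip_evenM.
by rewrite /kahler flip_even_sum (eq_bigr _ (fun b _ => flip_block_sigma i b)).
Qed.

(** The flip of the line fixes Sigma and the top form (a line has an even number
    of coordinates) but changes the sign of dx_p dx_q dx_r dx_s. *)
Lemma berezin_odd_block p q r s m :
  odd ((blk p == a) + (blk q == a) + ((blk r == a) + (blk s == a))) ->
  berezin (dx_pair R p q * dx_pair R r s * even_Sigma ^+ m) = 0.
Proof.
move=> oa; set x := _ * _ * _.
have : berezin (flip_even B x) = berezin x.
  by rewrite berezin_flip_even -signr_odd (negbTE card_block) mul1r.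
rewrite /x !flip_evenM flip_evenX flip_block_Sigma !flip_even_dx_pair !inE.
rewrite -scalerAl -scalerAr scalerA -scalerAl berezinZ -exprD -signr_odd -/x.
rewrite (_ : odd _ = true) ?expr1; first by lra.
by move: oa; rewrite !oddD; do 4 case: (_ == a).
Qed.
End Flip.

Lemma enum_rem (a : 'I_n) : perm_eq (enum 'I_n) (a :: rem a (enum 'I_n)).
Proof. exact/perm_to_rem/mem_enum. Qed.

(** The volume form of the line a kills every term of Sigma that involves a, and
    what remains is the top power of Sigma on the n - 1 other lines. *)
Lemma one_block_Sigma_exp (a : 'I_n) (hn : (0 < n)%N) :
  block_volume a * even_Sigma ^+ n.-1 = (top_coef n.-1)%:R * even_volume.
Proof.
set l := rem a (enum 'I_n).
have sl : size l = n.-1 by rewrite size_rem ?mem_enum // size_enum_ord.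
rewrite /even_Sigma (fundamental_perm (enum_rem a)) -/l.
rewrite (vertical_fundamental_exp block_sigma_mul block_sigma_volume block_volume_sqr) -{1}sl.
rewrite (fundamental_top block_sigma_mul block_sigma_volume block_volume_sqr) sl.
by rewrite /even_volume /volume (perm_big _ (enum_rem a)) big_cons /= mulrCA.
Qed.

Lemma two_blocks_Sigma_exp (a b : 'I_n) k k' m m' (ab : a != b) :
  dx_pair R (pt a k) (pt a k') * dx_pair R (pt b m) (pt b m') * even_Sigma ^+ n.-1
  = ((\sum_(i < 3) quat i (pt a k) (pt a k') * quat i (pt b m) (pt b m'))
     * (3^-1 * (top_coef n.-1)%:R)) *: even_volume.
Proof.
set l1 := rem a (enum 'I_n); set l := rem b l1.
have bl1 : b \in l1 by rewrite mem_rem_uniq ?enum_uniq // !inE eq_sym ab mem_enum.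
have pl : perm_eq (enum 'I_n) (a :: b :: l).
  by apply: (perm_trans (enum_rem a)); rewrite perm_cons; exact: perm_to_rem.
have sl : (size l).+1 = n.-1.
  by move: (perm_size pl); rewrite size_enum_ord /= => /(congr1 predn).
rewrite /even_Sigma (fundamental_perm pl) -{1}sl.
rewrite (two_blocks_top third3 block_sigma_mul block_sigma_volume block_volume_sqr
  (gc := fun i => (quat i (pt a k) (pt a k'))%:A)
  (hc := fun i => (quat i (pt b m) (pt b m'))%:A)); first last.
- by move=> i; rewrite dx_pair_block_sigma mulr_algl.
- by move=> i; rewrite dx_pair_block_sigma mulr_algl.
- exact: dx_pair_block_volume.
- exact: dx_pair_block_volume.
rewrite sl /even_volume /volume (perm_big _ pl) /= -/(volume _ _); set V := volume _ _.
rewrite [X in X * _](_ : _ = ((\sum_(i < 3) quat i (pt a k) (pt a k') * quat i (pt b m) (pt b m')) *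
   (3^-1 * (top_coef n.-1)%:R))%:A).
  by rewrite mulr_algl.
under eq_bigr => i _ do rewrite mulr_algl scalerA.
rewrite -scaler_suml -mulrA mulr_algl -scalerA; congr (_ *: _).
by rewrite /third mulr_algl -scalerA; congr (_ *: _); rewrite scaler_nat.
Qed.

End Blocks.

Arguments quat R {n} i.

(** * The top coefficient of dx_p dx_q dx_r dx_s Sigma^(n-1) *)
Section Orientation.
Variables (R : realType).

(** Volume forms of increasing blocks multiply without sign. *)
Lemma wedge_indicator (N : nat) (x y : Defs.form N R^o) (A B : {set 'I_N}) :
  (forall S, x S = (S == A)%:R) -> (forall S, y S = (S == B)%:R) ->
  {in A & B, forall i j : 'I_N, (i < j)%N} ->
  forall S, wedge_real x y S = (S == A :|: B)%:R.
Proof.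
move=> xA yB AB S; rewrite wedge_realE.
have dAB : B :\: A = B.
  apply/finset.setDidPl; rewrite disjoint_sym; apply/pred0P => i /=; apply/negP => /andP[iA iB].
  by have := AB _ _ iA iB; rewrite ltnn.
case: (boolP (A \subset S)) => AS; last first.
  rewrite big1 => [|C CS]; first by case: eqP AS => // ->; rewrite finset.subsetUl.
  rewrite xA; case: eqP => [CA|_]; last by rewrite mul0r mulr0.
  by move: AS; rewrite -CA CS.
rewrite (bigD1 A) //= big1 ?addr0 => [|C /andP[_ /negbTE CA]]; last first.
  by rewrite xA CA mul0r mulr0.
rewrite xA eqxx mul1r yB.
have -> : (S :\: A == B) = (S == A :|: B).
  apply/eqP/eqP => [<-|->].
    by apply/setP => i; rewrite !inE; case: (boolP (i \in A)) => // /(fintype.subsetP AS).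
  by rewrite finset.setDUl finset.setDv finset.set0U.
case: eqP => [->|_]; last by rewrite mulr0.
by rewrite finset.setDUl finset.setDv finset.set0U dAB shuffle_sign_lt ?mulr1.
Qed.

Lemma dx_pair_lt (N : nat) (p q : 'I_N) : (p < q)%N ->
  forall S, even_val (dx_pair R p q) S = (S == [set p; q])%:R.
Proof.
move=> pq; apply: wedge_indicator; first exact: dxE; first exact: dxE.
by move=> i j; rewrite !inE => /eqP-> /eqP->.
Qed.

Variable n : nat.

Lemma block_volumeE (a : 'I_n) S : even_val (block_volume R a) S = (S == [set p | blk p == a])%:R.
Proof.
rewrite (wedge_indicator (A := [set pt a k0; pt a k1]) (B := [set pt a k2; pt a k3])).
- congr (_ == _)%:R; apply/setP => p; rewrite !inE -!orbA -(ptK p) !pt_eq blk_pt.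
  by case: (_ == a) => //=; elim/ord4_ind: (pos p).
- by apply: dx_pair_lt => /=; lia.
- by apply: dx_pair_lt => /=; lia.
- by move=> i j; rewrite !inE => /orP[] /eqP-> /orP[] /eqP-> /=; lia.
Qed.

Lemma volume_blocksE (l : seq 'I_n) S : sorted (fun a b : 'I_n => (a < b)%N) l ->
  even_val (volume (@block_volume R n) l) S = (S == [set p | blk p \in l])%:R.
Proof.
elim: l S => [|a l IH] S sl.
  rewrite /volume big_nil (_ : [set p | blk p \in [::]] = finset.set0); first exact: ffunE.
  by apply/setP => p; rewrite !inE.
rewrite volume_cons (wedge_indicator (block_volumeE a) (fun S => IH S (path_sorted sl))).
  by congr (_ == _)%:R; apply/setP => p; rewrite !inE.
move=> p q; rewrite !inE => /eqP pa ql.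
rewrite ltnNge; apply/negP => /blk_leq; rewrite pa leqNgt => /negP; apply.
have tr : transitive (fun a b : 'I_n => (a < b)%N) by move=> ? ? ?; exact: ltn_trans.
by have /allP := order_path_min tr sl; exact.
Qed.

Lemma berezin_even_volume : berezin (even_volume R n) = 1.
Proof.
rewrite /berezin volume_blocksE.
  rewrite (_ : _ == _ = true) //; apply/eqP/setP => p; rewrite !inE.
  by rewrite mem_enum.
have := iota_ltn_sorted 0 n; rewrite -val_enum_ord sorted_map.
by apply: sub_sorted.
Qed.

(** This says that * Sigma^(n-1) is (2n-1)!/(3 * 2^(n-1)) Sigma. *)
Lemma berezin_quartic p q r s : (0 < n)%N ->
  berezin (dx_pair R p q * dx_pair R r s * even_Sigma R n ^+ n.-1)
  = quartic R p q r s * (3^-1 * (top_coef n.-1)%:R).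
Proof.
move=> n0; apply/eqP; rewrite -subr_eq0; apply/eqP; move: p q r s.
pose W := even_Sigma R n ^+ n.-1; rewrite -/W; set c := 3^-1 * _.
have bN (x : evenform R (4 * n)) : berezin (- x) = - berezin x by rewrite -scaleN1r berezinZ mulN1r.
have cQ (p q r s : 'I_(4 * n)) : quartic R q p r s = - quartic R p q r s.
  by rewrite /quartic -sumrN; apply: eq_bigr => i _; rewrite (quatN R i p q); ring.
apply: alternating_ind => p q r s.
- rewrite (dx_pairC _ q) !mulNr bN cQ; ring.
- rewrite dx_pair_swap !mulNr bN (_ : quartic _ _ _ _ _ = - quartic R p q r s).
    by ring.
  by rewrite /quartic -sumrN; apply: eq_bigr => i _; rewrite (quatN R i q r); ring.
- rewrite (dx_pairC _ s) mulrN !mulNr bN (_ : quartic _ _ _ _ _ = - quartic R p q r s).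
    by ring.
  by rewrite /quartic -sumrN; apply: eq_bigr => i _; rewrite (quatN R i r s); ring.
case/andP=> pq qr rs.
have qN (i : 'I_3) (x y : 'I_(4 * n)) : (blk x < blk y)%N -> quat R i x y = 0.
  by move=> xy; rewrite quat_blk // -val_eqE /= neq_ltn xy.
have bpq := blk_leq (ltnW pq); have bqr := blk_leq (ltnW qr); have brs := blk_leq (ltnW rs).
case: (ltngtP (blk p) (blk q)) => [lpq|gpq|/val_inj epq].
- rewrite (berezin_odd_block _ (a := blk p)).
    rewrite sub0r (_ : quartic _ _ _ _ _ = 0) ?mul0r ?oppr0 //.
    rewrite /quartic big1 // => i _; rewrite !(qN i p); [|lia..].
    by rewrite !mul0r subr0 addr0.
  by rewrite eqxx -!(inj_eq (@ord_inj _)) !gtn_eqF; [|lia..].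
- by move: bpq; rewrite leqNgt gpq.
case: (ltngtP (blk r) (blk s)) => [lrs|grs|/val_inj ers].
- rewrite (berezin_odd_block _ (a := blk s)).
    rewrite sub0r (_ : quartic _ _ _ _ _ = 0) ?mul0r ?oppr0 //.
    rewrite /quartic big1 // => i _; rewrite !(qN i _ s); [|lia..].
    by rewrite !mulr0 !mul0r subr0 addr0.
  by rewrite eqxx -!(inj_eq (@ord_inj _)) !ltn_eqF; [|lia..].
- by move: brs; rewrite leqNgt grs.
case: (ltngtP (blk q) (blk r)) => [lqr|gqr|/val_inj eqr].
- rewrite -(ptK p) -(ptK q) -(ptK r) -(ptK s) epq ers.
  rewrite /W two_blocks_Sigma_exp; last first.
    by rewrite -ers -(inj_eq (@ord_inj _)) neq_ltn lqr.
  rewrite berezinZ berezin_even_volume mulr1 -/c -mulrBl /quartic -sumrB big1 ?mul0r // => i _.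
  have z k l : quat R i (pt (blk q) k) (pt (blk s) l) = 0 by rewrite qN // !blk_pt -ers.
  by rewrite !z; ring.
- by move: bqr; rewrite leqNgt gqr.
set a := blk p.
have [ep eq er es] : [/\ p = pt a k0, q = pt a k1, r = pt a k2 & s = pt a k3].
  have e1 : (p %/ 4 = q %/ 4)%N by have := congr1 val epq.
  have e2 : (q %/ 4 = r %/ 4)%N by have := congr1 val eqr.
  have e3 : (r %/ 4 = s %/ 4)%N by have := congr1 val ers.
  by split; apply: val_inj => /=; lia.
rewrite ep eq er es.
have -> : dx_pair R (pt a k0) (pt a k1) * dx_pair R (pt a k2) (pt a k3) = block_volume R a by [].
rewrite /W one_block_Sigma_exp //.
have bZ m (x : evenform R (4 * n)) : berezin (m%:R * x) = m%:R * berezin x.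
  by rewrite mulr_natl -scaler_nat berezinZ.
rewrite bZ berezin_even_volume mulr1 (_ : quartic _ _ _ _ _ = 3); last first.
  rewrite /quartic !big_ord_recl big_ord0 !quat_pt eqxx !mul1r /=.
  by rewrite !(expr0, expr1, mulr0, mulr1, mul0r, mul1r, mulN1r, mulrN1); lra.
by rewrite /c mulrA mulfV ?pnatr_eq0 // mul1r subrr.
Qed.

End Orientation.

(** * The defect of anti-self-duality of a two-form *)
Section AsdOperator.
Variables (R : realType) (n : nat).
Local Notation N := (4 * n)%N.
Local Notation S := (quat R (n := n)).
Implicit Types (M : 'M[R]_N) (p q r s : 'I_N).

Definition twoform M : evenform R N := \sum_p \sum_q M p q *: dx_pair R p q.

(** The matrix of contractions of the two-form of M with Sigma, shifted so that
    it vanishes on sp(n): there M - M^t commutes with the S_i and is orthogonal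
    to them, so that each S_i (M - M^t) S_i is - (M - M^t). *)
Definition asd_defect M : 'M[R]_N :=
  \sum_(i < 3) (\tr (M^T *m S i) *: S i + S i *m (M - M^T) *m S i)
  + 3%:R *: (M - M^T).

Definition asd_op (V : lmodType R) (a : Defs.form N V) : Defs.form N V :=
  wedge_real a (wedge_pow (Sigma R n) (n - 1)) - c1 R n *: hodge a.

Lemma trmx_quat i : (S i)^T = - S i.
Proof. by apply/matrixP => p q; rewrite mxE [RHS]mxE quatN. Qed.

Lemma mulmx3E (A B C : 'M[R]_N) p q :
  (A *m B *m C) p q = \sum_r \sum_s A p r * B r s * C s q.
Proof.
rewrite mxE; under eq_bigr => s _ do rewrite mxE mulr_suml.
by rewrite exchange_big.
Qed.

(** The three terms of [quartic], summed against M, are a trace and two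
    conjugates by S_i; the last two combine because S_i is antisymmetric. *)
Lemma quartic_contraction M p q : \sum_r \sum_s M r s * quartic R p q r s
  = (\sum_(i < 3) (\tr (M^T *m S i) *: S i + S i *m (M - M^T) *m S i)) p q.
Proof.
under eq_bigr => r _.
  under eq_bigr => s _ do rewrite /quartic mulr_sumr.
  rewrite exchange_big.
  over.
rewrite exchange_big summxE; apply: eq_bigr => i _ /=.
rewrite mulmxBr mulmxBl [RHS]mxE [X in _ = X + _]mxE [X in _ = _ + X]mxE.
rewrite [X in _ = _ + (_ + X)]mxE !mulmx3E.
have -> : \tr (M^T *m S i) = \sum_r \sum_s M r s * S i r s.
  rewrite exchange_big; apply: eq_bigr => r _; rewrite mxE; apply: eq_bigr => s _.
  by rewrite [M^T _ _]mxE.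
rewrite [X in _ - X]exchange_big mulr_suml -sumrB -big_split /=; apply: eq_bigr => r _.
rewrite mulr_suml -sumrB -big_split /=; apply: eq_bigr => s _.
rewrite [M^T _ _]mxE (quatN R i s q) (quatN R i r q); ring.
Qed.

Lemma dx2_pt (j : 'I_n) (k l : 'I_4) :
  dx2 (4 * j + k.+1) (4 * j + l.+1) = even_val (dx_pair R (pt j k) (pt j l)).
Proof. by rewrite !addnS. Qed.

Lemma even_valD (a b : evenform R N) : even_val (a + b) = even_val a + even_val b.
Proof. by []. Qed.

Lemma even_valZ k (a : evenform R N) : even_val (k *: a) = k *: even_val a.
Proof. by []. Qed.

Lemma even_valN (a : evenform R N) : even_val (- a) = - even_val a.
Proof. by []. Qed.

Lemma even_val_sum (T : Type) (l : seq T) (P : pred T) (F : T -> evenform R N) :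
  even_val (\sum_(i <- l | P i) F i) = \sum_(i <- l | P i) even_val (F i).
Proof. by elim/big_rec2: _ => [|i x y _ <-]. Qed.

Lemma even_val_Sigma : even_val (even_Sigma R n) = Sigma R n.
Proof.
have K (i : 'I_3) : even_val (kahler (@block_sigma R n) i (enum 'I_n))
    = \sum_(j < n) (even_val (first_plane R i j) + even_val (second_plane R i j)).
  by rewrite /kahler even_val_sum big_enum.
rewrite /even_Sigma fundamentalE even_valZ even_val_sum !big_ord_recl big_ord0 addr0 addrA.
rewrite /Sigma; congr (_ *: (_ + _ + _)); rewrite even_valM /wedge_pow /= wedge_real1r.
- by congr wedge_real; rewrite K /sigma1; apply: eq_bigr => j _;
  rewrite -(dx2_pt j k0 k1) -(dx2_pt j k2 k3).
- by congr wedge_real; rewrite K /sigma2; apply: eq_bigr => j _;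
  rewrite -(dx2_pt j k0 k2) -(dx2_pt j k3 k1).
- by congr wedge_real; rewrite K /sigma3; apply: eq_bigr => j _;
  rewrite -(dx2_pt j k0 k3) -(dx2_pt j k1 k2).
Qed.

Lemma top_coef_fact k : (top_coef k * 2 ^ k)%N = (2 * k + 1)`!.
Proof.
elim: k => [|k IH]; first by rewrite /top_coef big_ord0.
rewrite top_coefS (_ : 2 * k.+1 + 1 = (2 * k + 1).+2)%N; last by lia.
by rewrite !factS -IH expnS; lia.
Qed.

Lemma c1E : (0 < n)%N -> c1 R n = - (top_coef n.-1)%:R.
Proof.
move=> n0; rewrite /c1 (_ : 2 * n - 1 = 2 * n.-1 + 1)%N ?subn1; last by lia.
by rewrite -top_coef_fact natrM natrX mulfK // expf_neq0 // pnatr_eq0.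
Qed.

Definition homogeneous (d : nat) (a : Defs.form N R^o) : Prop :=
  forall T : {set 'I_N}, #|T| != d -> a T = 0.

Lemma homogeneous_wedge d d' a b : homogeneous d a -> homogeneous d' b ->
  homogeneous (d + d') (wedge_real a b).
Proof.
move=> ha hb T cT; rewrite wedge_realE big1 // => A AT.
case: (boolP (#|A| == d)) => [/eqP dA|dA]; last by rewrite ha // mul0r mulr0.
rewrite hb ?mulr0 //; apply: contra_neq cT => <-.
by rewrite -dA -(cardsID A T) (finset.setIidPr AT).
Qed.

Lemma homogeneous_sum d (I : finType) (F : I -> Defs.form N R^o) :
  (forall i, homogeneous d (F i)) -> homogeneous d (\sum_i F i).
Proof.
move=> hF T cT; elim/big_rec: _ => [|i x _ hx]; first by rewrite ffunE.
by rewrite ffunE hF // hx addr0.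
Qed.

Lemma homogeneousZ d k a : homogeneous d a -> homogeneous d (k *: a).
Proof. by move=> ha T cT; rewrite ffunE ha // scaler0. Qed.

Lemma homogeneousD d a b : homogeneous d a -> homogeneous d b -> homogeneous d (a + b).
Proof. by move=> ha hb T cT; rewrite ffunE ha // hb // addr0. Qed.

Lemma homogeneous_pair p q : homogeneous 2 (even_val (dx_pair R p q)).
Proof.
move=> T cT; rewrite /= dx_dxE; case: (boolP (p != q)) => [pq|_]; last by rewrite mul0r.
case: eqP => [E|_]; last by rewrite mul0r.
by move: cT; rewrite E cards2 pq.
Qed.

Lemma homogeneous_pow d a k : homogeneous d a -> homogeneous (k * d) (wedge_pow a k).
Proof.
move=> ha; elim: k => [|k IH]; last by rewrite mulSn; exact: homogeneous_wedge.
move=> T; rewrite mul0n cards_eq0 => /negbTE cT.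
by rewrite ffunE cT.
Qed.

Lemma homogeneous_Sigma : homogeneous 4 (Sigma R n).
Proof.
have s2 (i : 'I_3) : homogeneous 2 (even_val (kahler (@block_sigma R n) i (enum 'I_n))).
  rewrite /kahler even_val_sum big_enum; apply: homogeneous_sum => j.
  by rewrite even_valD; apply: homogeneousD; elim/ord3_ind: i; exact: homogeneous_pair.
rewrite -even_val_Sigma /even_Sigma fundamentalE even_valZ even_val_sum.
by apply/homogeneousZ/homogeneous_sum => i; apply: (@homogeneous_wedge 2 2); exact: s2.
Qed.

Lemma homogeneous_twoform M : homogeneous 2 (even_val (twoform M)).
Proof.
rewrite /twoform even_val_sum; apply: homogeneous_sum => p.
rewrite even_val_sum; apply: homogeneous_sum => q.
exact/homogeneousZ/homogeneous_pair.
Qed.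

Lemma sum_delta2 (x : 'I_N -> 'I_N -> R) p q :
  \sum_r \sum_s x r s * ((r == p) && (s == q))%:R = x p q.
Proof.
rewrite (bigD1 p) //= [X in _ + X]big1 => [|r /negbTE rp].
  rewrite (bigD1 q) //= big1 => [|s /negbTE sq]; first by rewrite !eqxx mulr1 !addr0.
  by rewrite sq andbF mulr0.
by apply: big1 => s _; rewrite rp mulr0.
Qed.

Lemma pair_coef p q r s : p != q -> even_val (dx_pair R r s) [set p; q]
  = ((r == p) && (s == q))%:R * shuffle_sign R [set p] [set q]
    - ((r == q) && (s == p))%:R * shuffle_sign R [set p] [set q].
Proof.
move=> pq; rewrite /= dx_dxE.
have sC : shuffle_sign R [set q] [set p] = - shuffle_sign R [set p] [set q].
  by rewrite (@shuffle_signC _ _ [set p]) ?cards1 ?expr1 ?mulN1r // disjoints1 inE.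
have [/andP[/eqP-> /eqP->]|h1] := boolP ((r == p) && (s == q)).
  by rewrite (negbTE pq) !eqxx /= mul0r subr0.
have [/andP[/eqP-> /eqP->]|h2] := boolP ((r == q) && (s == p)).
  have qp : q != p by rewrite eq_sym.
  by rewrite qp finset.setUC !eqxx sC /= mul0r !mul1r sub0r.
rewrite (_ : (r != s) && _ = false) ?mul0r ?subr0 //.
apply/negP => /andP[rs /eqP E].
have : r \in [set p; q] by rewrite E !inE eqxx.
have : s \in [set p; q] by rewrite E !inE eqxx orbT.
rewrite !inE => /orP[] /eqP se /orP[] /eqP re; move: h1 h2 rs;
  by rewrite se re ?eqxx.
Qed.

Lemma twoform_coef M p q : p != q ->
  even_val (twoform M) [set p; q] = shuffle_sign R [set p] [set q] * (M p q - M q p).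
Proof.
move=> pq; set c := shuffle_sign _ _ _.
rewrite -(sum_delta2 M p q) -(sum_delta2 M q p) -sumrB mulr_sumr /twoform even_val_sum.
rewrite sum_ffunE; apply: eq_bigr => r _; rewrite even_val_sum sum_ffunE -sumrB mulr_sumr.
apply: eq_bigr => s _; rewrite even_valZ ffunE pair_coef // -/c /GRing.scale /=; ring.
Qed.

Lemma asd_opE (V : lmodType R) (a : Defs.form N V) T :
  asd_op a T = wedge_real a (wedge_pow (Sigma R n) (n - 1)) T
    - c1 R n *: (shuffle_sign R (~: T) T *: a (~: T)).
Proof. by rewrite /asd_op ffunE [X in _ + X]ffunE [X in _ - X]ffunE [hodge _ _]ffunE. Qed.

(** Both terms of the operator are homogeneous of degree 4 n - 2. *)
Lemma asd_op_twoform M (T : {set 'I_N}) : (0 < n)%N -> #|~: T| != 2 ->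
  asd_op (even_val (twoform M)) T = 0.
Proof.
move=> n0 cT; rewrite asd_opE homogeneous_twoform // !scaler0 subr0.
have := homogeneous_wedge (homogeneous_twoform M)
  (homogeneous_pow (k := (n - 1)%N) homogeneous_Sigma).
apply; apply: contra_neq cT => cT.
by have := cardsC T; rewrite cT card_ord; lia.
Qed.

Lemma asd_defectE M p q : asd_defect M p q
  = (\sum_(i < 3) (\tr (M^T *m S i) *: S i + S i *m (M - M^T) *m S i)) p q
    + 3 * (M p q - M q p).
Proof. by rewrite mxE; congr (_ + _); rewrite 4!mxE. Qed.

(** Pairing with dx_p dx_q turns F(M) /\ Sigma^(n-1) into a sum of the numbers
    of [berezin_quartic], and * F(M) into M_pq - M_qp; the constant c_1 is -3
    times the constant of [berezin_quartic]. *)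
Lemma asd_op_twoform_pair M p q : (0 < n)%N -> p != q ->
  asd_op (even_val (twoform M)) (~: [set p; q])
  = shuffle_sign R [set p] [set q] * shuffle_sign R [set p; q] (~: [set p; q])
    * (3^-1 * (top_coef n.-1)%:R) * asd_defect M p q.
Proof.
move=> n0 pq; set T := ~: _; set s1 := shuffle_sign _ _ _; set s2 := shuffle_sign _ _ _.
have s12 : s1 * s2 * (s1 * s2) = 1.
  by rewrite mulrACA !shuffle_sign_sqr mulr1.
have X := berezin_dx_pair (twoform M * even_Sigma R n ^+ n.-1) pq.
rewrite -/T -/s1 -/s2 in X.
rewrite asd_opE.
have -> : wedge_real (even_val (twoform M)) (wedge_pow (Sigma R n) (n - 1)) T
   = s1 * s2 * berezin (dx_pair R p q * (twoform M * even_Sigma R n ^+ n.-1)).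
  by rewrite X mulrA s12 mul1r even_valM even_valX even_val_Sigma subn1.
rewrite finset.setCK twoform_coef // -/s1 -/s2.
have -> : berezin (dx_pair R p q * (twoform M * even_Sigma R n ^+ n.-1))
  = 3^-1 * (top_coef n.-1)%:R * \sum_r \sum_s M r s * quartic R p q r s.
  rewrite /twoform mulr_suml mulr_sumr berezin_sum mulr_sumr; apply: eq_bigr => r _.
  rewrite mulr_suml mulr_sumr berezin_sum mulr_sumr; apply: eq_bigr => s _.
  rewrite -scalerAl -scalerAr berezinZ mulrA berezin_quartic //; ring.
rewrite quartic_contraction c1E // asd_defectE /GRing.scale /=.
set x := fun_of_matrix (\sum_(i < 3) _) p q; set c := (top_coef _)%:R.
by field.
Qed.

End AsdOperator.

(** * Symmetric matrices and a quaternionic structure *)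
Section QuaternionAlgebra.
Variables (R : realType) (N : nat).
Variables A B C : 'M[R]_N.
Hypotheses (AA : A *m A = - 1%:M) (BB : B *m B = - 1%:M) (CC : C *m C = - 1%:M).
Hypotheses (AB : A *m B = - C) (BC : B *m C = - A) (CA : C *m A = - B).
Hypotheses (BA : B *m A = C) (CB : C *m B = A) (AC : A *m C = B).
Hypotheses (At : A^T = - A) (Bt : B^T = - B) (Ct : C^T = - C).
Variable H : 'M[R]_N.
Hypothesis Ht : H^T = H.

Lemma mulN1mx (X : 'M[R]_N) : - 1%:M *m X = - X.
Proof. by rewrite mulNmx mul1mx. Qed.

Let AAx (X : 'M[R]_N) : A *m (A *m X) = - X. Proof. by rewrite mulmxA AA mulN1mx. Qed.
Let BBx (X : 'M[R]_N) : B *m (B *m X) = - X. Proof. by rewrite mulmxA BB mulN1mx. Qed.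
Let CCx (X : 'M[R]_N) : C *m (C *m X) = - X. Proof. by rewrite mulmxA CC mulN1mx. Qed.
Let ABx (X : 'M[R]_N) : A *m (B *m X) = - (C *m X). Proof. by rewrite mulmxA AB mulNmx. Qed.
Let BCx (X : 'M[R]_N) : B *m (C *m X) = - (A *m X). Proof. by rewrite mulmxA BC mulNmx. Qed.
Let CAx (X : 'M[R]_N) : C *m (A *m X) = - (B *m X). Proof. by rewrite mulmxA CA mulNmx. Qed.
Let BAx (X : 'M[R]_N) : B *m (A *m X) = C *m X. Proof. by rewrite mulmxA BA. Qed.
Let CBx (X : 'M[R]_N) : C *m (B *m X) = A *m X. Proof. by rewrite mulmxA CB. Qed.
Let ACx (X : 'M[R]_N) : A *m (C *m X) = B *m X. Proof. by rewrite mulmxA AC. Qed.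
Let quatE := (AA, BB, CC, AB, BC, CA, BA, CB, AC).
Let quatEx := (AAx, BBx, CCx, ABx, BCx, CAx, BAx, CBx, ACx).
Local Ltac expand := rewrite ?(mulmxDl, mulmxDr, mulmxBl, mulmxBr, mulNmx, mulmxN, mulmx1, opprK).
Local Ltac reduce := do 3 (expand; rewrite -?mulmxA ?quatE ?quatEx); expand.

(** Up to the factor 1/4, the projection of H on the symmetric matrices which
    commute with A, B and C. *)
Definition hermitian_part : 'M[R]_N := H - (A *m H *m A + B *m H *m B + C *m H *m C).

Lemma antisym_trace X : X^T = - X -> \tr (H *m X) = 0.
Proof.
move=> Xt; have : \tr (H *m X) = - \tr (H *m X); last by lra.
by rewrite -[LHS]mxtrace_tr trmx_mul Xt Ht mulNmx raddfN /= mxtrace_mulC.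
Qed.

Lemma hermitian_partA : hermitian_part *m A = H *m A + A *m H - B *m H *m C + C *m H *m B.
Proof.
rewrite /hermitian_part; reduce.
by apply/matrixP => p q; rewrite !mxE; ring.
Qed.

Lemma mulA_hermitian_part : A *m hermitian_part = hermitian_part *m A.
Proof.
rewrite hermitian_partA /hermitian_part; reduce.
by apply/matrixP => p q; rewrite !mxE; ring.
Qed.

Definition quaternionic_defect (M : 'M[R]_N) : 'M[R]_N :=
  \tr (M^T *m A) *: A + A *m (M - M^T) *m A
  + (\tr (M^T *m B) *: B + B *m (M - M^T) *m B)
  + (\tr (M^T *m C) *: C + C *m (M - M^T) *m C) + 3%:R *: (M - M^T).

(** Expand with the quaternion relations.  The traces against B and C are traces
    of a product of a symmetric and an antisymmetric matrix. *)
Lemma quaternionic_defect_sym_mulA : quaternionic_defect (H *m A)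
  = (\tr H *: 1%:M + 2%:R *: hermitian_part) *m A.
Proof.
have HAt : (H *m A)^T = - (A *m H) by rewrite trmx_mul Ht At mulNmx.
have trX X : \tr ((H *m A)^T *m X) = - \tr (H *m (X *m A)).
  by rewrite HAt mulNmx raddfN /= -mulmxA mxtrace_mulC -mulmxA.
rewrite /quaternionic_defect !trX AA BA CA HAt.
rewrite !mulmxN mulmx1 raddfN /= !opprK (antisym_trace Ct) raddfN /= (antisym_trace Bt).
rewrite !oppr0 !scale0r !add0r [RHS]mulmxDl -!scalemxAl mul1mx hermitian_partA.
reduce.
move: (A *m H) (H *m A) => X Y.
by apply/matrixP => p q; rewrite !mxE; ring.
Qed.

(** For H = a^t a this is, up to sign, the two-form
    J^j a /\ J^k a - a /\ J^i a; the identity is linear in H. *)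
Lemma quaternionic_defect_cross :
  quaternionic_defect (H *m A + B *m H *m C) = 0.
Proof.
have HAt : (H *m A + B *m H *m C)^T = - (A *m H) + C *m (H *m B).
  by rewrite raddfD /= !trmx_mul Ht At Bt Ct; reduce.
have trX X : \tr ((H *m A + B *m H *m C)^T *m X)
    = - \tr (H *m (X *m A)) + \tr (H *m (B *m X *m C)).
  rewrite HAt mulmxDl raddfD /= mulNmx raddfN /=.
  by congr (_ + _); rewrite -?mulmxA mxtrace_mulC -?mulmxA.
rewrite /quaternionic_defect !trX HAt; reduce.
rewrite !raddfN /= (antisym_trace Bt) (antisym_trace Ct) !oppr0.
apply/matrixP => p q; rewrite !mxE; ring.
Qed.

End QuaternionAlgebra.

Section QuaternionicStructure.
Variables (R : realType) (n : nat).
Local Notation N := (4 * n)%N.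
Local Notation S := (quat R (n := n)).
Implicit Types (i j : 'I_3) (H M : 'M[R]_N).

Lemma quat_mulE i j a k b l : (S i *m S j) (pt a k) (pt b l)
  = (a == b)%:R * ((-1) ^+ (neg4 i k + neg4 j (rho4 i k)) * (l == rho4 j (rho4 i k))%:R).
Proof.
rewrite mxE (bigD1 (pt a (rho4 i k))) //= big1 ?addr0 => [|p].
  by rewrite !quat_pt !eqxx !(mul1r, mulr1) exprD; ring.
rewrite -(ptK p) pt_eq => /nandP[/negbTE h|/negbTE h]; rewrite quat_pt.
  by rewrite eq_sym h mul0r mul0r.
by rewrite h !(mulr0, mul0r).
Qed.

Lemma ordS_unit_i : ordS unit_i = unit_j. Proof. exact: val_inj. Qed.
Lemma ordS_unit_j : ordS unit_j = unit_k. Proof. exact: val_inj. Qed.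
Lemma ordS_unit_k : ordS unit_k = unit_i. Proof. exact: val_inj. Qed.

(** Products of signed permutations are compared through the permutations and
    the signs. *)
Lemma quat_relation i j l (b : bool) :
  (forall k, rho4 j (rho4 i k) = rho4 l k) ->
  (forall k, odd (neg4 i k + neg4 j (rho4 i k)) = b (+) neg4 l k) ->
  S i *m S j = (-1) ^+ b *: S l.
Proof.
move=> hrho hneg; apply/matrixP => p q; rewrite [RHS]mxE -(ptK p) -(ptK q).
rewrite quat_mulE quat_pt hrho -signr_odd hneg signr_addb; ring.
Qed.

Lemma quat_mul_succ i : S i *m S (ordS i) = - S (ordS (ordS i)).
Proof.
rewrite -scaleN1r -[in RHS](expr1 (-1)) -[in RHS]/(nat_of_bool true).
by apply: quat_relation => k; elim/ord3_ind: i;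
  rewrite ?(ordS_unit_i, ordS_unit_j, ordS_unit_k); elim/ord4_ind: k.
Qed.

Lemma quat_succ_mul i : S (ordS i) *m S i = S (ordS (ordS i)).
Proof.
rewrite -[RHS]scale1r -[in RHS](expr0 (-1)) -[in RHS]/(nat_of_bool false).
by apply: quat_relation => k; elim/ord3_ind: i;
  rewrite ?(ordS_unit_i, ordS_unit_j, ordS_unit_k); elim/ord4_ind: k.
Qed.

Lemma quat_sqr i : S i *m S i = - 1%:M.
Proof.
apply/matrixP => p q; rewrite [RHS]mxE [1%:M p q]mxE -(ptK p) -(ptK q).
rewrite quat_mulE pt_eq [pos p == _]eq_sym.
case: (blk p == _); rewrite ?mul0r ?oppr0 // mul1r /=.
have [-> s] : rho4 i (rho4 i (pos p)) = pos p /\ odd (neg4 i (pos p) + neg4 i (rho4 i (pos p))).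
  by elim/ord3_ind: i; elim/ord4_ind: (pos p).
by rewrite -signr_odd s expr1 mulN1r.
Qed.

Lemma neq_ordS i j : j != i -> (j == ordS i) || (j == ordS (ordS i)).
Proof. by elim/ord3_ind: i; elim/ord3_ind: j. Qed.

Lemma ordS3 i : ordS (ordS (ordS i)) = i.
Proof. by elim/ord3_ind: i; rewrite !(ordS_unit_i, ordS_unit_j, ordS_unit_k). Qed.

Lemma quat_mul_succ2 i : S (ordS (ordS i)) *m S i = - S (ordS i).
Proof. by rewrite -{2}(ordS3 i) quat_mul_succ ordS3. Qed.

Lemma quat_succ2_mul i : S i *m S (ordS (ordS i)) = S (ordS i).
Proof. by rewrite -{1}(ordS3 i) quat_succ_mul ordS3. Qed.

Lemma quat_succ_mul_succ2 i : S (ordS i) *m S (ordS (ordS i)) = - S i.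
Proof. by rewrite quat_mul_succ ordS3. Qed.

Lemma quat_succ2_mul_succ i : S (ordS (ordS i)) *m S (ordS i) = S i.
Proof. by rewrite quat_succ_mul ordS3. Qed.

Let quat_table := (quat_sqr, quat_succ_mul_succ2, quat_succ2_mul_succ, quat_mul_succ2,
  quat_succ2_mul, quat_mul_succ, quat_succ_mul).

Lemma sum_ordS (V : nmodType) (F : 'I_3 -> V) i :
  \sum_j F j = F i + F (ordS i) + F (ordS (ordS i)).
Proof.
rewrite !big_ord_recl big_ord0 addr0 addrA.
have -> : ord0 = unit_i :> 'I_3 by exact: val_inj.
have -> : lift unit_i ord0 = unit_j :> 'I_3 by exact: val_inj.
have -> : lift unit_i (lift ord0 ord0) = unit_k :> 'I_3 by exact: val_inj.
elim/ord3_ind: i; rewrite !(ordS_unit_i, ordS_unit_j, ordS_unit_k) //.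
  by rewrite -addrA addrC.
by rewrite addrC addrA.
Qed.

Lemma asd_defect_cyc i M :
  asd_defect M = quaternionic_defect (S i) (S (ordS i)) (S (ordS (ordS i))) M.
Proof. by rewrite /asd_defect (sum_ordS _ i). Qed.

Definition hermitian H : 'M[R]_N := H - \sum_i S i *m H *m S i.
Definition defect_factor H : 'M[R]_N := \tr H *: 1%:M + 2%:R *: hermitian H.

Lemma hermitian_cyc i H :
  hermitian H = hermitian_part (S i) (S (ordS i)) (S (ordS (ordS i))) H.
Proof. by rewrite /hermitian (sum_ordS _ i). Qed.

(** The factor does not depend on i: this is what makes the equations for the
    three structures equivalent. *)
Lemma asd_defect_sym i H : H^T = H -> asd_defect (H *m S i) = defect_factor H *m S i.
Proof.
move=> Ht; rewrite (asd_defect_cyc i) /defect_factor (hermitian_cyc i).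
by apply: quaternionic_defect_sym_mulA; rewrite ?trmx_quat ?quat_table.
Qed.

Lemma asd_defect_cross i H : H^T = H ->
  asd_defect (H *m S i + S (ordS i) *m H *m S (ordS (ordS i))) = 0.
Proof.
move=> Ht; rewrite (asd_defect_cyc i).
by apply: quaternionic_defect_cross; rewrite ?trmx_quat ?quat_table.
Qed.

Lemma defect_factorC i H : S i *m defect_factor H = defect_factor H *m S i.
Proof.
rewrite /defect_factor (hermitian_cyc i) mulmxDr mulmxDl -!scalemxAr -!scalemxAl mulmx1 mul1mx.
by rewrite (mulA_hermitian_part (B := S (ordS i))) ?quat_table.
Qed.

Lemma trmx_defect_factor H : H^T = H -> (defect_factor H)^T = defect_factor H.
Proof.
move=> Ht; rewrite /defect_factor /hermitian raddfD /= !linearZ /= trmx1 raddfB /= Ht.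
congr (_ + _ *: (_ - _)); rewrite raddf_sum /=; apply: eq_bigr => i _.
by rewrite !trmx_mul Ht trmx_quat !(mulNmx, mulmxN) opprK mulmxA.
Qed.

(** Multiply on the left by K and on the right by S_i, and look at the diagonal:
    for j != i the matrix K^2 S_j S_i is antisymmetric, being up to sign the
    product of the symmetric K^2 with a third S_l which commutes with it.  What
    remains is K^2 v_i, and the diagonal of K^2 consists of the squared norms of
    the rows of K. *)
Lemma factor_eq0 (V : lmodType R) (K : 'M[R]_N) (v : 'I_3 -> V) (i : 'I_3) :
  K^T = K -> (forall j, S j *m K = K *m S j) ->
  (forall p q, \sum_j (K *m S j) p q *: v j = 0) -> v i != 0 -> K = 0.
Proof.
move=> Kt KS K0 vi.
(* Linear combinations of the entries of the hypothesis. *)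
have comb (A B : 'M[R]_N) p q : \sum_j (A *m (K *m S j) *m B) p q *: v j = 0.
  under eq_bigr => j _ do rewrite mulmx3E scaler_suml.
  under eq_bigr => j _ do under eq_bigr => r _ do rewrite scaler_suml.
  rewrite exchange_big big1 // => r _; rewrite exchange_big big1 // => s _ /=.
  transitivity ((A p r * B s q) *: \sum_j (K *m S j) r s *: v j).
    rewrite scaler_sumr; apply: eq_bigr => j _; rewrite scalerA; congr (_ *: _); ring.
  by rewrite K0 scaler0.
have KKS j : (K *m K) *m S j = S j *m (K *m K) by rewrite -mulmxA -KS !mulmxA KS.
have KK_diag p j : (K *m K *m S j) p p = 0.
  have : (K *m K *m S j)^T = - (K *m K *m S j).
    by rewrite !trmx_mul Kt trmx_quat mulNmx KKS.
  by move=> /(congr1 (fun X : 'M[R]_(N) => X p p)); rewrite !mxE; lra.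
have KKpp p : (K *m K) p p = 0.
  have := comb K (S i) p p; rewrite (bigD1 i) //= big1 => [|j ji].
    rewrite addr0 -!mulmxA quat_sqr !mulmxN mulmx1 => /eqP.
    by rewrite scaler_eq0 (negbTE vi) orbF mxE oppr_eq0 => /eqP.
  have [l [b E]] : exists l, exists b : R, S j *m S i = b *: S l.
    have /orP[/eqP->|/eqP->] : (j == ordS i) || (j == ordS (ordS i)).
      exact: neq_ordS.
    - by exists (ordS (ordS i)), 1; rewrite quat_table scale1r.
    - by exists (ordS i), (-1); rewrite quat_table scaleN1r.
  by rewrite -!mulmxA E -!scalemxAr !mulmxA mxE KK_diag mulr0 scale0r.
apply/matrixP => p q; rewrite [RHS]mxE.
have Ks r s : K r s = K s r by rewrite -{1}Kt mxE.
have : \sum_r (K p r) ^+ 2 == 0.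
  by rewrite -[X in _ == X](KKpp p) mxE; apply/eqP; apply: eq_bigr => r _; rewrite (Ks r p).
rewrite psumr_eq0 => [|r _]; last exact: sqr_ge0.
by move=> /allP /(_ q); rewrite mem_index_enum sqrf_eq0 => /(_ isT) /eqP.
Qed.

End QuaternionicStructure.

(** * Vector-valued forms *)
Section VectorValued.
Variables (R : realType) (N : nat).
Local Notation sgn := (@shuffle_sign R N).

Lemma wedge_realVE (V : lmodType R) (a : Defs.form N V) (b : Defs.form N R^o) T :
  wedge_real a b T = \sum_(A : {set 'I_N} | A \subset T)
    sgn A (T :\: A) *: (b (T :\: A) *: a A).
Proof. by rewrite ffunE. Qed.

Lemma wedge_tensor (V W X : lmodType R) (m : V -> W -> X)
    (mZl : forall k v w, m (k *: v) w = k *: m v w)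
    (mZr : forall k v w, m v (k *: w) = k *: m v w)
    (a b : Defs.form N R^o) v w :
  wedge m (tensor a v) (tensor b w) = tensor (wedge_real a b) (m v w).
Proof.
apply/ffunP => T; rewrite !ffunE scaler_suml; apply: eq_bigr => A AT.
rewrite !ffunE mZl mZr !scalerA; congr (_ *: _).
by rewrite /GRing.scale /=; ring.
Qed.

Lemma wedge_sum (V W X : lmodType R) (m : V -> W -> X)
    (m0l : forall w, m 0 w = 0) (m0r : forall v, m v 0 = 0)
    (mDl : forall v v' w, m (v + v') w = m v w + m v' w)
    (mDr : forall v w w', m v (w + w') = m v w + m v w')
    (I J : finType) (F : I -> Defs.form N V) (G : J -> Defs.form N W) :
  wedge m (\sum_i F i) (\sum_j G j) = \sum_i \sum_j wedge m (F i) (G j).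
Proof.
have suml (K : finType) (f : K -> V) w : m (\sum_i f i) w = \sum_i m (f i) w.
  by elim/big_rec2: _ => // i x y _ <-; rewrite mDl.
have sumr (K : finType) (f : K -> W) v : m v (\sum_i f i) = \sum_i m v (f i).
  by elim/big_rec2: _ => // i x y _ <-; rewrite mDr.
apply/ffunP => T; rewrite ffunE sum_ffunE.
transitivity (\sum_(A : {set 'I_N} | A \subset T) \sum_i \sum_j
  sgn A (T :\: A) *: m (F i A) (G j (T :\: A))).
  apply: eq_bigr => A _; rewrite !sum_ffunE suml scaler_sumr; apply: eq_bigr => i _.
  by rewrite sumr scaler_sumr.
rewrite exchange_big; apply: eq_bigr => i _; rewrite sum_ffunE exchange_big.
by apply: eq_bigr => j _; rewrite ffunE.
Qed.

Lemma tensorDr (V : lmodType R) (a : Defs.form N R^o) (v w : V) :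
  tensor a (v + w) = tensor a v + tensor a w.
Proof. by apply/ffunP => T; rewrite !ffunE scalerDr. Qed.

Lemma tensorDl (V : lmodType R) (a b : Defs.form N R^o) (v : V) :
  tensor (a + b) v = tensor a v + tensor b v.
Proof. by apply/ffunP => T; rewrite !ffunE scalerDl. Qed.

Lemma tensorNr (V : lmodType R) (a : Defs.form N R^o) (v : V) :
  tensor a (- v) = - tensor a v.
Proof. by apply/ffunP => T; rewrite !ffunE scalerN. Qed.

Lemma tensorNl (V : lmodType R) (a : Defs.form N R^o) (v : V) :
  tensor (- a) v = - tensor a v.
Proof. by apply/ffunP => T; rewrite !ffunE scaleNr. Qed.

Lemma tensorZ (V : lmodType R) k (a : Defs.form N R^o) (v : V) :
  tensor a (k *: v) = tensor (k *: a) v.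
Proof. by apply/ffunP => T; rewrite !ffunE scalerA mulrC. Qed.

Lemma tensor0l (V : lmodType R) (v : V) : tensor (0 : Defs.form N R^o) v = 0.
Proof. by apply/ffunP => T; rewrite !ffunE scale0r. Qed.

Lemma tensor_suml (V : lmodType R) (I : finType) (F : I -> Defs.form N R^o) (v : V) :
  tensor (\sum_i F i) v = \sum_i tensor (F i) v.
Proof. by elim/big_rec2: _ => [|i x y _ <-]; rewrite ?tensor0l ?tensorDl. Qed.

Lemma tensor_sumr (V : lmodType R) (I : finType) (a : Defs.form N R^o) (F : I -> V) :
  tensor a (\sum_i F i) = \sum_i tensor a (F i).
Proof.
apply/ffunP => T; rewrite !ffunE sum_ffunE scaler_sumr.
by apply: eq_bigr => i _; rewrite ffunE.
Qed.

Local Notation dx p := (dx (nat_of_ord p).+1 : Defs.form N R^o).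

Definition oneform (a : 'rV[R]_N) : Defs.form N R^o := \sum_p a 0 p *: dx p.

Lemma oneform_set1 a p : oneform a [set p] = a 0 p.
Proof.
rewrite /oneform sum_ffunE (bigD1 p) //= big1 ?addr0 => [|q /negbTE qp].
  by rewrite ffunE dxE eqxx /GRing.scale /= mulr1.
by rewrite ffunE dxE (inj_eq finset.set1_inj) eq_sym qp scaler0.
Qed.

(** For a one-form, d is sum_p dx_p /\ d/dx_p.  A coefficient of degree other
    than one vanishes identically, so that the derivatives of the b q are the
    only ones that occur. *)
Lemma ext_d_oneform (V : normedModType R) (b : 'I_N -> 'rV[R]_N -> V) x :
  ext_d (fun y => \sum_q tensor (dx q) (b q y)) x
  = \sum_p \sum_q tensor (even_val (dx_pair R p q)) (partial (b q) p x).
Proof.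
have coef y T : (\sum_q tensor (dx q) (b q y)) T = \sum_q (T == [set q])%:R *: b q y.
  by rewrite sum_ffunE; apply: eq_bigr => q _; rewrite ffunE dxE.
have partial_coef T p : partial (fun y => (\sum_q tensor (dx q) (b q y)) T) p x
    = \sum_q (T == [set q])%:R *: partial (b q) p x.
  case: (boolP [exists q, T == [set q]]) => [/existsP[q0 /eqP ->]|/existsPn nT].
    have pick (F : 'I_N -> V) : \sum_q ([set q0] == [set q])%:R *: F q = F q0.
      rewrite (bigD1 q0) //= eqxx scale1r big1 ?addr0 // => q /negbTE qq.
      by rewrite (inj_eq finset.set1_inj) eq_sym qq scale0r.
    rewrite pick /partial; congr ('D_ _ _ _).
    by apply/funext => y; rewrite coef pick.
  rewrite big1 => [|q _]; last by rewrite (negbTE (nT q)) scale0r.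
  rewrite /partial (_ : (fun y => _) = cst 0) ?derive_cst //.
  by apply/funext => y; rewrite coef big1 // => q _; rewrite (negbTE (nT q)) scale0r.
apply/ffunP => T; rewrite ffunE sum_ffunE [LHS]big_mkcond /=; apply: eq_bigr => p _.
rewrite partial_coef sum_ffunE.
case: (boolP (p \in T)) => pT; last first.
  by rewrite big1 // => q _; rewrite ffunE /= dx_wedgeE (negbTE pT) mul0r scale0r.
rewrite scaler_sumr; apply: eq_bigr => q _.
by rewrite ffunE /= dx_wedgeE dxE pT mul1r scalerA.
Qed.

End VectorValued.

Section AsdVectorValued.
Variables (R : realType) (n : nat).
Local Notation N := (4 * n)%N.
Local Notation S := (quat R (n := n)).

Lemma asd_op_sum (V : lmodType R) (I : finType) (F : I -> Defs.form N V) :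
  asd_op (\sum_i F i) = \sum_i asd_op (F i).
Proof.
apply/ffunP => T; rewrite asd_opE [RHS]sum_ffunE.
under [RHS]eq_bigr => i _ do rewrite asd_opE.
rewrite sumrB; congr (_ - _); last by rewrite sum_ffunE !scaler_sumr.
under [RHS]eq_bigr => i _ do rewrite wedge_realVE.
rewrite wedge_realVE exchange_big; apply: eq_bigr => A _.
by rewrite sum_ffunE !scaler_sumr.
Qed.

Lemma asd_opD (V : lmodType R) (a b : Defs.form N V) : asd_op (a + b) = asd_op a + asd_op b.
Proof.
pose F (i : bool) := if i then a else b.
by have := asd_op_sum F; rewrite !big_bool.
Qed.

Lemma asd_op_tensor (V : lmodType R) (a : Defs.form N R^o) (v : V) :
  asd_op (tensor a v) = tensor (asd_op a) v.
Proof.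
apply/ffunP => T; rewrite asd_opE [RHS]ffunE asd_opE scalerBl; congr (_ - _); last first.
  by rewrite ffunE !scalerA.
rewrite !wedge_realVE scaler_suml; apply: eq_bigr => A _.
by rewrite ffunE !scalerA.
Qed.

Lemma asd_opP (V : lmodType R) (a : Defs.form N V) :
  wedge_real a (wedge_pow (Sigma R n) (n - 1)) = c1 R n *: hodge a <-> asd_op a = 0.
Proof.
by split => [E|/eqP]; [rewrite /asd_op E subrr|rewrite subr_eq0 => /eqP].
Qed.

Lemma twoformD M M' : twoform (n := n) (M + M') = twoform M + twoform (R := R) M'.
Proof.
rewrite /twoform -big_split; apply: eq_bigr => p _; rewrite -big_split.
by apply: eq_bigr => q _; rewrite mxE scalerDl.
Qed.

Lemma twoformN M : twoform (n := n) (- M) = - twoform (R := R) M.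
Proof.
rewrite /twoform -sumrN; apply: eq_bigr => p _; rewrite -sumrN.
by apply: eq_bigr => q _; rewrite mxE scaleNr.
Qed.

Lemma twoform_tr M : twoform (n := n) M^T = - twoform (R := R) M.
Proof.
rewrite /twoform exchange_big -sumrN; apply: eq_bigr => p _; rewrite -sumrN.
by apply: eq_bigr => q _; rewrite mxE dx_pairC scalerN.
Qed.

Lemma wedge_oneform (a b : 'rV[R]_N) :
  wedge_real (oneform a) (oneform b) = even_val (twoform (a^T *m b)).
Proof.
rewrite /wedge_real /oneform wedge_sum => [|w|v|v v' w|v w w'].
- rewrite /twoform even_val_sum; apply: eq_bigr => p _.
  rewrite even_val_sum; apply: eq_bigr => q _.
  rewrite -/(wedge_real _ _) wedge_realZl wedge_realZr scalerA even_valZ.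
  by congr (_ *: _); rewrite mxE big_ord1 mxE.
- exact: scaler0.
- exact: scale0r.
- exact: scalerDr.
- exact: scalerDl.
Qed.

Lemma rho4K i : involutive (rho4 i).
Proof. by move=> k; elim/ord3_ind: i; elim/ord4_ind: k. Qed.

Lemma mul_row_quat (g : 'rV[R]_N) i j l : (g *m S i) 0 (pt j l)
  = (-1) ^+ neg4 i (rho4 i l) * g 0 (pt j (rho4 i l)).
Proof.
rewrite mxE (bigD1 (pt j (rho4 i l))) //= big1 ?addr0 => [|p].
  by rewrite quat_pt eqxx rho4K eqxx mul1r mulr1 mulrC.
rewrite -(ptK p) pt_eq quat_pt => /nandP[/negbTE ->|h]; first by rewrite mul0r mulr0.
rewrite (_ : l == _ = false) ?mulr0 //.
by apply/negbTE; apply: contra_neq h => ->; rewrite rho4K.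
Qed.

Lemma J_oneform i (g : 'rV[R]_N) : J i (oneform g) = oneform (g *m S i).
Proof.
have sg (j : 'I_n) (k : 'I_4) : oneform g (idx (4 * j + k.+1)) = g 0 (pt j k).
  by rewrite addnS (idx_ord (pt j k)) oneform_set1.
have dxk (j : 'I_n) (k : 'I_4) : dx (4 * j + k.+1) = dx (pt j k).+1 :> Defs.form N R^o.
  by rewrite addnS.
have ord4 (F : 'I_4 -> Defs.form N R^o) : \sum_k F k = F k0 + F k1 + F k2 + F k3.
  rewrite !big_ord_recl big_ord0 addr0 !addrA.
  by congr (F _ + F _ + F _ + F _); exact: val_inj.
pose G j k : Defs.form N R^o := (g *m S i) 0 (pt j k) *: dx (pt j k).+1.
transitivity (\sum_(j < n) (G j k0 + G j k1 + G j k2 + G j k3)); last first.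
  by rewrite [RHS]sum_pt; apply: eq_bigr => j _; rewrite -(ord4 (G j)).
rewrite /G; elim/ord3_ind: i G => _; apply: eq_bigr => j _; rewrite !mul_row_quat.
- rewrite (sg j k1) (sg j k0) (sg j k3) (sg j k2).
  rewrite (dxk j k0) (dxk j k1) (dxk j k2) (dxk j k3) /=.
  by rewrite !(expr0, expr1, mul1r, mulN1r) !scaleNr.
- rewrite (sg j k2) (sg j k3) (sg j k0) (sg j k1).
  rewrite (dxk j k0) (dxk j k1) (dxk j k2) (dxk j k3) /=.
  by rewrite !(expr0, expr1, mul1r, mulN1r) !scaleNr.
- rewrite (sg j k3) (sg j k2) (sg j k1) (sg j k0).
  rewrite (dxk j k0) (dxk j k1) (dxk j k2) (dxk j k3) /=.
  by rewrite !(expr0, expr1, mul1r, mulN1r) !scaleNr.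
Qed.

End AsdVectorValued.

(** * The curvature at a point *)
Section LieBracket.
Variables (R : realType) (g : normedModType R) (br : g -> g -> g).
Hypothesis hbr : lie_bracket br.

Lemma brDl v v' w : br (v + v') w = br v w + br v' w.
Proof. by have := lie_linear_l hbr w 1 v v'; rewrite !scale1r. Qed.

Lemma brDr v w w' : br v (w + w') = br v w + br v w'.
Proof. by have := lie_linear_r hbr v 1 w w'; rewrite !scale1r. Qed.

Lemma br0l w : br 0 w = 0.
Proof. by apply: (@addrI _ (br 0 w)); rewrite -brDl !addr0. Qed.

Lemma br0r v : br v 0 = 0.
Proof. by apply: (@addrI _ (br v 0)); rewrite -brDr !addr0. Qed.

Lemma brZl k v w : br (k *: v) w = k *: br v w.
Proof. by have := lie_linear_l hbr w k v 0; rewrite br0l !addr0. Qed.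

Lemma brZr k v w : br v (k *: w) = k *: br v w.
Proof. by have := lie_linear_r hbr v k w 0; rewrite br0r !addr0. Qed.

Lemma brC v w : br v w = - br w v.
Proof.
apply/eqP; rewrite -subr_eq0 opprK; apply/eqP.
have := lie_alternating hbr (v + w).
by rewrite brDl !brDr !(lie_alternating hbr) add0r addr0.
Qed.

Lemma br_suml (I : finType) (F : I -> g) w : br (\sum_i F i) w = \sum_i br (F i) w.
Proof. by elim/big_rec2: _ => [|i x y _ <-]; rewrite ?br0l ?brDl. Qed.

Lemma br_sumr (I : finType) (F : I -> g) v : br v (\sum_i F i) = \sum_i br v (F i).
Proof. by elim/big_rec2: _ => [|i x y _ <-]; rewrite ?br0r ?brDr. Qed.

End LieBracket.

Lemma sum_sym3 (V : zmodType) (F : 'I_3 -> 'I_3 -> V) :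
  (forall j k, F j k = F k j) -> (forall j, F j j = 0) ->
  \sum_j \sum_k F j k = (\sum_i F (ordS i) (ordS (ordS i))) *+ 2.
Proof.
move=> Fsym F0; rewrite !(sum_ordS _ unit_i) !(ordS_unit_i, ordS_unit_j, ordS_unit_k) !F0.
rewrite (Fsym unit_j unit_i) (Fsym unit_k unit_i) (Fsym unit_k unit_j) add0r !addr0 mulr2n.
by rewrite [LHS](AC (2*2*2) ((4*2*1)*(6*5*3))).
Qed.

Lemma top_coef_gt0 k : (0 < top_coef k)%N.
Proof. by rewrite /top_coef prodn_gt0 // => j; rewrite muln_gt0 /= addn_gt0 orbT. Qed.

Lemma shuffle_sign_neq0 (R : realType) (N : nat) (A B : {set 'I_N}) :
  shuffle_sign R A B != 0.
Proof. by rewrite shuffle_signE signr_eq0. Qed.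

Lemma asd_op_twoform0 (R : realType) (n : nat) (M : 'M[R]_(4 * n)) :
  (0 < n)%N -> asd_defect M = 0 -> asd_op (even_val (twoform M)) = 0.
Proof.
move=> n0 M0; apply/ffunP => T; rewrite [RHS]ffunE.
have [/cards2P[p [q [pq E]]]|cT] := boolP (#|~: T| == 2); last by apply: asd_op_twoform.
by rewrite -(finset.setCK T) E asd_op_twoform_pair // M0 mxE mulr0.
Qed.

(** The analytic input at the point x is the matrix H of second derivatives and
    the two product rules [gradH] and [omegaH]; the latter contains Nahm's
    equations. *)
Section ConnectionAtPoint.
Variables (R : realType) (n : nat).
Hypothesis n0 : (0 < n)%N.
Local Notation N := (4 * n)%N.
Local Notation S := (quat R (n := n)).
Variables (g : normedModType R) (br : g -> g -> g).
Hypothesis hbr : lie_bracket br.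
Variables (f : 'rV[R]_N -> R) (T : 'I_3 -> R -> g) (x : 'rV[R]_N).

Definition grad (y : 'rV[R]_N) : 'rV[R]_N := \row_p partial (f : 'rV[R]_N -> R^o) p y.

Lemma df_oneform y : df f y = oneform (grad y).
Proof. by rewrite /df /oneform; apply: eq_bigr => p _; rewrite mxE. Qed.

Variable H : 'M[R]_N.
Hypothesis Ht : H^T = H.
Hypothesis gradH : forall i p q,
  partial (fun y => (grad y *m S i) 0 q : R^o) p x = (H *m S i) p q.
Local Notation t i := (T i (f x)).
Hypothesis omegaH : forall p q,
  partial (fun y => - \sum_i (grad y *m S i) 0 q *: T i (f y)) p x
  = - \sum_i ((H *m S i) p q *: t i
      + (grad x 0 p * (grad x *m S i) 0 q) *: br (t (ordS i)) (t (ordS (ordS i)))).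

Lemma dJdf_twoform i : dJdf f i x = even_val (twoform (H *m S i)).
Proof.
rewrite /dJdf (_ : (fun y => _) = (fun y => \sum_q tensor (dx (nat_of_ord q).+1 : Defs.form N R^o)
    ((grad y *m S i) 0 q : R^o))); last first.
  apply/funext => y; rewrite df_oneform J_oneform /oneform; apply: eq_bigr => q _.
  by apply/ffunP => A; rewrite !ffunE /GRing.scale /= mulrC.
rewrite ext_d_oneform /twoform even_val_sum; apply: eq_bigr => p _.
rewrite even_val_sum; apply: eq_bigr => q _; rewrite gradH.
by apply/ffunP => A; rewrite !ffunE /GRing.scale /= mulrC.
Qed.

Lemma omega_oneform y : - omega f T y = \sum_q tensor (dx (nat_of_ord q).+1 : Defs.form N R^o)
  (- \sum_i (grad y *m S i) 0 q *: T i (f y)).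
Proof.
rewrite /omega -sumrN.
under [RHS]eq_bigr => q _ do rewrite -sumrN tensor_sumr.
rewrite exchange_big; apply: eq_bigr => i _.
rewrite df_oneform J_oneform /oneform tensor_suml -sumrN; apply: eq_bigr => q _.
by rewrite tensorNr tensorZ.
Qed.

Lemma ext_d_omega : ext_d (fun y => - omega f T y) x
  = - \sum_i (tensor (even_val (twoform (H *m S i))) (t i)
      + tensor (even_val (twoform ((grad x)^T *m (grad x *m S i))))
               (br (t (ordS i)) (t (ordS (ordS i))))).
Proof.
rewrite (funext omega_oneform) ext_d_oneform.
under eq_bigr => p _ do under eq_bigr => q _ do rewrite omegaH tensorNr tensor_sumr.
under eq_bigr => p _ do rewrite sumrN exchange_big.
rewrite sumrN exchange_big; congr (- _); apply: eq_bigr => i _.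
under eq_bigr => p _ do under eq_bigr => q _ do rewrite tensorDr !tensorZ.
rewrite /twoform !even_val_sum !tensor_suml -big_split; apply: eq_bigr => p _ /=.
rewrite !even_val_sum !tensor_suml -big_split; apply: eq_bigr => q _ /=.
by rewrite [((grad x)^T *m _) p q]mxE big_ord1 [(grad x)^T p 0]mxE.
Qed.

Lemma wedge_omega : 2^-1 *: wedge br (- omega f T x) (- omega f T x)
  = \sum_i tensor (even_val (twoform ((grad x *m S (ordS i))^T *m (grad x *m S (ordS (ordS i))))))
               (br (t (ordS i)) (t (ordS (ordS i)))).
Proof.
have E : - omega f T x = \sum_i tensor (oneform (grad x *m S i)) (- t i).
  rewrite /omega -sumrN; apply: eq_bigr => i _.
  by rewrite df_oneform J_oneform tensorNr.
rewrite E wedge_sum; first last.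
- exact: brDr. - exact: brDl. - exact: br0r. - exact: br0l.
pose F j k := tensor (even_val (twoform ((grad x *m S j)^T *m (grad x *m S k)))) (br (t j) (t k)).
transitivity (2^-1 *: \sum_j \sum_k F j k).
  congr (_ *: _); apply: eq_bigr => j _; apply: eq_bigr => k _.
  rewrite wedge_tensor; [|exact: brZl|exact: brZr].
  rewrite wedge_oneform /F; congr tensor.
  by rewrite -scaleN1r -[- t k]scaleN1r brZl // brZr // scalerA mulrNN mulr1 scale1r.
rewrite sum_sym3.
- by rewrite -[X in _ *: X]scaler_nat scalerA mulVf ?scale1r // pnatr_eq0.
- move=> j k; rewrite /F (brC hbr (t j)).
  have -> : (grad x *m S j)^T *m (grad x *m S k) = ((grad x *m S k)^T *m (grad x *m S j))^T.
    by rewrite [RHS]trmx_mul trmxK.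
  by rewrite twoform_tr even_valN tensorNr tensorNl opprK.
- by move=> j; rewrite /F (lie_alternating hbr); apply/ffunP => A; rewrite !ffunE scaler0.
Qed.

(** The terms with brackets assemble into the two-forms of
    [quaternionic_defect_cross], for the rank one matrix H = (df)^t df, and do
    not contribute to the defect. *)
Lemma asd_op_curvature : asd_op (curvature br (fun y => - omega f T y) x)
  = - \sum_i tensor (asd_op (even_val (twoform (H *m S i)))) (t i).
Proof.
rewrite /curvature ext_d_omega wedge_omega big_split opprD -addrA -[X in _ + (X + _)]sumrN.
rewrite -[X in _ + X]big_split /=.
have -> : \sum_i (- tensor (even_val (twoform ((grad x)^T *m (grad x *m S i))))
               (br (t (ordS i)) (t (ordS (ordS i))))
   + tensor (even_val (twoform ((grad x *m S (ordS i))^T *m (grad x *m S (ordS (ordS i))))))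
               (br (t (ordS i)) (t (ordS (ordS i)))))
  = - \sum_i tensor (even_val (twoform ((grad x)^T *m grad x *m S i
       + S (ordS i) *m ((grad x)^T *m grad x) *m S (ordS (ordS i)))))
               (br (t (ordS i)) (t (ordS (ordS i)))).
  rewrite -sumrN; apply: eq_bigr => i _.
  rewrite twoformD even_valD tensorDl opprD !mulmxA; congr (_ + _).
  by rewrite trmx_mul trmx_quat !mulNmx twoformN even_valN tensorNl.
rewrite asd_opD -!sumrN !asd_op_sum [X in _ + X]big1 ?addr0 => [|i _].
  by apply: eq_bigr => i _; rewrite -tensorNr asd_op_tensor tensorNr.
rewrite -tensorNr asd_op_tensor asd_op_twoform0 ?tensor0l //.
by apply: asd_defect_cross; rewrite trmx_mul trmxK.
Qed.

Hypothesis T0 : exists i, t i != 0.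

Lemma asd_curvatureP : asd_op (curvature br (fun y => - omega f T y) x) = 0 <->
  forall i, asd_op (dJdf f i x) = 0.
Proof.
rewrite asd_op_curvature.
split => [E i|E]; last first.
  by rewrite big1 ?oppr0 // => i _; rewrite -dJdf_twoform E tensor0l.
have [l tl] := T0.
rewrite dJdf_twoform; apply: asd_op_twoform0 => //; rewrite (asd_defect_sym i Ht).
suff -> : defect_factor H = 0 by rewrite mul0mx.
apply: (factor_eq0 (v := fun j => t j) (i := l)) tl.
- exact: trmx_defect_factor.
- by move=> j; exact: defect_factorC.
move=> p q; have [<-|pq] := eqVneq p q.
  rewrite big1 // => j _; suff -> : (defect_factor H *m S j) p p = 0 by rewrite scale0r.
  have : (defect_factor H *m S j)^T = - (defect_factor H *m S j).
    by rewrite trmx_mul trmx_quat trmx_defect_factor // mulNmx defect_factorC.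
  by move=> /(congr1 (fun X : 'M[R]_(N) => X p p)); rewrite !mxE; lra.
have := congr1 (fun F : Defs.form N g => F (~: [set p; q])) E.
rewrite ffunE sum_ffunE ffunE => /eqP; rewrite oppr_eq0 => /eqP.
under eq_bigr => j _ do rewrite ffunE asd_op_twoform_pair // asd_defect_sym // -scalerA.
rewrite -scaler_sumr => /eqP; rewrite scaler_eq0 => /orP[|/eqP //].
rewrite !mulf_eq0 invr_eq0 !pnatr_eq0 !(negbTE (shuffle_sign_neq0 _ _ _)) /=.
by rewrite (negbTE (lt0n_neq0 (top_coef_gt0 _))).
Qed.

End ConnectionAtPoint.

(** * Directional derivatives and the symmetry of the Hessian *)
Section DirectionalDerivatives.
Local Open Scope classical_set_scope.
Variables (R : realType) (V W : normedModType R).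
Implicit Types (F : V -> W) (x v : V).

Lemma derivable_cvg F x v : derivable F x v ->
  h^-1 *: (F (h *: v + x) - F x) @[h --> (0 : R)^'] --> 'D_v F x.
Proof. by []. Qed.

Lemma cvg_is_derive F x v (d : W) :
  h^-1 *: (F (h *: v + x) - F x) @[h --> (0 : R)^'] --> d -> is_derive x v F d.
Proof.
move=> c; apply: DeriveDef; first by apply/cvg_ex; exists d.
exact: (cvg_lim (@norm_hausdorff _ _) c).
Qed.

End DirectionalDerivatives.

Section Translations.
Local Open Scope classical_set_scope.
Variables (R : realType) (V W : normedModType R).
Implicit Types (F : V -> W) (x v : V).

Lemma is_derive_shift_cst F x v y (d : W) : is_derive (x + y) v F d ->
  is_derive x v (fun z => F (z + y)) d.
Proof.
move=> dF; apply: cvg_is_derive.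
have := derivable_cvg (@ex_derive _ _ _ _ _ _ _ dF); rewrite derive_val.
by under eq_fun do rewrite addrA.
Qed.

Lemma is_derive_line F x v (t : R) (d : W) : is_derive (t *: v + x) v F d ->
  is_derive t (1 : R) (fun s : R => F (s *: v + x)) d.
Proof.
move=> dF; apply: cvg_is_derive.
have := derivable_cvg (@ex_derive _ _ _ _ _ _ _ dF); rewrite derive_val => cF.
suff -> : (fun h : R => h^-1 *: (F ((h *: (1 : R) + t) *: v + x) - F (t *: v + x)))
  = (fun h => h^-1 *: (F (h *: v + (t *: v + x)) - F (t *: v + x))) by [].
by apply/funext => h; rewrite [h *: 1]mulr1 scalerDl -addrA.
Qed.

End Translations.

Section Clairaut.
Local Open Scope classical_set_scope.
Variables (R : realType) (V : normedModType R).
Implicit Types (F : V -> R^o) (x v w : V).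

Lemma MVT_line F x v (h : R) : 0 < h ->
  (forall t, 0 <= t <= h -> derivable F (t *: v + x) v) ->
  exists2 t, 0 < t < h & F (h *: v + x) - F x = 'D_v F (t *: v + x) * h.
Proof.
move=> h0 dF; pose u (s : R) : R^o := F (s *: v + x).
have du t : 0 <= t <= h -> is_derive t (1 : R) u ('D_v F (t *: v + x)).
  by move=> /dF /derivableP; exact: is_derive_line.
have [] := @MVT R u (fun t => 'D_v F (t *: v + x)) 0 h h0.
- by move=> t; rewrite in_itv /= => /andP[t0 th]; apply: du; rewrite !ltW.
- apply: derivable_within_continuous => t; rewrite in_itv /= => t0h.
  exact: (@ex_derive _ _ _ _ _ _ _ (du t t0h)).
move=> t; rewrite in_itv /= => t0h; rewrite subr0 /u scale0r add0r => E.
by exists t.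
Qed.

(** Two applications of the mean value theorem: to y |-> F (y + h w) - F y in the
    direction v, then to the derivative of F along v, in the direction w. *)
Lemma second_difference F x v w (h : R) : 0 < h ->
  (forall s t, 0 <= s <= h -> 0 <= t <= h ->
    derivable F (s *: v + (t *: w + x)) v /\
    derivable ('D_v F) (t *: w + (s *: v + x)) w) ->
  exists s t, [/\ 0 < s < h, 0 < t < h &
    F (h *: v + (h *: w + x)) - F (h *: v + x) - (F (h *: w + x) - F x)
    = 'D_w ('D_v F) (t *: w + (s *: v + x)) * h * h].
Proof.
move=> h0 dF; pose G y : R^o := F (y + h *: w) - F y.
have hh : 0 <= h <= h by rewrite (ltW h0) lexx.
have h00 : 0 <= (0 : R) <= h by rewrite lexx ltW.
have dG s : 0 <= s <= h -> is_derive (s *: v + x) v G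
    ('D_v F (s *: v + x + h *: w) - 'D_v F (s *: v + x)).
  move=> s0h; apply: is_deriveB.
    apply: is_derive_shift_cst; apply: derivableP.
    by rewrite -addrA (addrC x); exact: (dF s h s0h hh).1.
  by apply: derivableP; have := (dF s 0 s0h h00).1; rewrite scale0r add0r.
have [s s0h] := MVT_line h0 (fun t ht => @ex_derive _ _ _ _ _ _ _ (dG t ht)).
have s0h' : 0 <= s <= h by case/andP: s0h => *; rewrite !ltW.
rewrite (@derive_val _ _ _ _ _ _ _ (dG s s0h')) /G => E1.
have [t t0h E2] := MVT_line h0 (fun t ht => (dF s t s0h' ht).2).
exists s, t; split => //.
move: E1; rewrite (addrC (s *: v + x)) E2 => <-.
by rewrite -(addrA (h *: v)) (addrC x).
Qed.

(** The second difference is symmetric in v and w, so values of the two mixed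
    derivatives at points arbitrarily close to x coincide. *)
Lemma Clairaut F x v w (U : set V) : open U -> U x ->
  (forall y, U y -> derivable F y v /\ derivable F y w) ->
  (forall y, U y -> derivable ('D_v F) y w /\ derivable ('D_w F) y v) ->
  {for x, continuous ('D_w ('D_v F))} -> {for x, continuous ('D_v ('D_w F))} ->
  'D_w ('D_v F) x = 'D_v ('D_w F) x.
Proof.
move=> oU Ux dF ddF c1 c2; apply/eqP; rewrite -subr_eq0 -normr_le0.
apply/ler_addgt0Pr => e e0; rewrite add0r.
have e2 : 0 < e / 2 by rewrite divr_gt0.
have n1 : \forall y \near x, `|'D_w ('D_v F) x - 'D_w ('D_v F) y| < e / 2.
  by move/cvgrPdist_lt : c1; apply.
have n2 : \forall y \near x, `|'D_v ('D_w F) x - 'D_v ('D_w F) y| < e / 2.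
  by move/cvgrPdist_lt : c2; apply.
have : nbhs x (fun y => [/\ U y, `|'D_w ('D_v F) x - 'D_w ('D_v F) y| < e / 2 &
    `|'D_v ('D_w F) x - 'D_v ('D_w F) y| < e / 2]).
  by apply: filterS3 (open_nbhs_nbhs (conj oU Ux)) n1 n2 => y ? ? ?; split.
clear n1 n2.
move=> /nbhs_ballP[d /= d0]; rewrite -ball_normE => near_x.
(* The parallelogram spanned by h v and h w stays in the ball of radius d. *)
pose c := `|v| + `|w| + 1.
have c0 : 0 < c by rewrite ltr_wpDl // addr_ge0.
pose h := d / 2 / c.
have h0 : 0 < h by rewrite !divr_gt0.
have box s t : 0 <= s <= h -> 0 <= t <= h -> `|x - (s *: v + (t *: w + x))| < d.
  move=> /andP[s0 sh] /andP[t0 th].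
  rewrite addrA [s *: v + _ + _]addrC opprD addrA subrr add0r normrN.
  apply: (le_lt_trans (ler_normD _ _)); rewrite !normrZ !ger0_norm //.
  apply: (@le_lt_trans _ _ (h * `|v| + h * `|w|)).
    by apply: lerD; apply: ler_wpM2r.
  rewrite -mulrDr; apply: (@le_lt_trans _ _ (d / 2)); last by rewrite gtr_pMr // invf_lt1 // ltr1n.
  by rewrite /h -mulrA ler_piMr ?divr_ge0 ?(ltW d0) // mulrC ler_pdivrMr // mul1r lerDl.
have box' s t : 0 <= s <= h -> 0 <= t <= h -> `|x - (t *: w + (s *: v + x))| < d.
  by move=> sh th; rewrite (addrCA (t *: w)); exact: box.
have [s [t [s0h t0h E1]]] : exists s t, [/\ 0 < s < h, 0 < t < h &
    F (h *: v + (h *: w + x)) - F (h *: v + x) - (F (h *: w + x) - F x)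
    = 'D_w ('D_v F) (t *: w + (s *: v + x)) * h * h].
  apply: second_difference; [exact: h0|move=> s t sh th; split].
    by have [/dF[? ?] _ _] := near_x _ (box s t sh th).
  by have [/ddF[? ?] _ _] := near_x _ (box' s t sh th).
have [t' [s' [t0h' s0h' E2]]] : exists s t, [/\ 0 < s < h, 0 < t < h &
    F (h *: w + (h *: v + x)) - F (h *: w + x) - (F (h *: v + x) - F x)
    = 'D_v ('D_w F) (t *: v + (s *: w + x)) * h * h].
  apply: second_difference; [exact: h0|move=> t' s' th sh; split].
    by have [/dF[? ?] _ _] := near_x _ (box' s' t' sh th).
  by have [/ddF[? ?] _ _] := near_x _ (box s' t' sh th).
have wk z : 0 < z < h -> 0 <= z <= h by case/andP => *; rewrite !ltW.
have [_ n1 _] := near_x _ (box' s t (wk _ s0h) (wk _ t0h)).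
have [_ _ n2] := near_x _ (box s' t' (wk _ s0h') (wk _ t0h')).
have E : 'D_w ('D_v F) (t *: w + (s *: v + x)) = 'D_v ('D_w F) (s' *: v + (t' *: w + x)).
  have cancel (b1 b2 b3 b4 y z : R) : b1 - b2 - (b3 - b4) = y * h * h ->
      b1 - b3 - (b2 - b4) = z * h * h -> y = z.
    move=> ea eb; have hn0 := lt0r_neq0 h0.
    by apply: (mulIf hn0); apply: (mulIf hn0); rewrite -ea -eb; ring.
  by apply: (cancel _ _ _ _ _ _ E1); rewrite (addrCA (h *: v)); exact: E2.
rewrite E in n1.
have triangle (a b z : R) : `|a - z| < e / 2 -> `|b - z| < e / 2 -> `|a - b| <= e.
  move=> az bz; apply: ltW; have -> : a - b = (a - z) - (b - z) by ring.
  by apply: (le_lt_trans (ler_normB _ _)); rewrite [e]splitr; exact: ltrD.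
exact: triangle n1 n2.
Qed.

End Clairaut.

(** * Product and chain rules *)
Section ContinuityAlongLines.
Local Open Scope classical_set_scope.
Variables (R : realType) (V W : normedModType R).
Implicit Types (x v : V).

Lemma cvg_line (F : V -> W) x v (d : W) : is_derive x v F d ->
  F (h *: v + x) @[h --> (0 : R)^'] --> F x.
Proof.
move=> dF; have c := derivable_cvg (@ex_derive _ _ _ _ _ _ _ dF).
(* The increment of F is h times its difference quotient. *)
have c' : h *: (h^-1 *: (F (h *: v + x) - F x)) + F x @[h --> (0 : R)^'] --> F x.
  rewrite -[X in _ --> X]add0r -(scale0r ('D_v F x)).
  apply: cvgD; last exact: cvg_cst.
  by apply: cvgZ => //; apply: nbhs_dnbhs.
apply: cvg_trans c'; apply: near_eq_cvg.
near=> h; have h0 : h != 0 by near: h; exact: nbhs_dnbhs_neq.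
by rewrite scalerA divff // scale1r subrK.
Unshelve. all: by end_near.
Qed.

End ContinuityAlongLines.

Section ProductAndChainRules.
Local Open Scope classical_set_scope.
Variables (R : realType) (V W : normedModType R).
Implicit Types (x v : V).

Lemma is_derive_scale (c : V -> R^o) (w : V -> W) x v (dc : R^o) (dw : W) :
  is_derive x v c dc -> is_derive x v w dw ->
  is_derive x v (fun y => (c y : R) *: w y) ((dc : R) *: w x + (c x : R) *: dw).
Proof.
move=> Dc Dw; apply: cvg_is_derive.
have c1 := derivable_cvg (@ex_derive _ _ _ _ _ _ _ Dc); rewrite derive_val in c1.
have c2 := derivable_cvg (@ex_derive _ _ _ _ _ _ _ Dw); rewrite derive_val in c2.
have c3 := cvg_line Dw.
have -> : (fun h : R => h^-1 *: ((c (h *: v + x) : R) *: w (h *: v + x) - (c x : R) *: w x))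
  = (fun h => (h^-1 *: (c (h *: v + x) - c x) : R) *: w (h *: v + x)
       + (c x : R) *: (h^-1 *: (w (h *: v + x) - w x))).
  apply/funext => h; set w1 := w (_ + _); set k := c (_ + _).
  have -> : (k : R) *: w1 - (c x : R) *: w x = (k - c x) *: w1 + (c x : R) *: (w1 - w x).
    by rewrite scalerBl scalerBr addrA subrK.
  by rewrite scalerDr !scalerA [c x * _]mulrC.
apply: cvgD; first exact: cvgZ.
by apply: cvgZr.
Qed.

(** The function f may reach an endpoint of I at x, where T is only
    differentiable on one side, and may take the value f x infinitely often near
    x; the difference quotient of T extended by its limit handles both. *)
Lemma is_derive_comp_on (I : interval R) (T : R -> W) (f : V -> R^o) x v (df : R^o) (l : W) :
  is_derive x v f df -> (\forall y \near x, (f y : R) \in I) ->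
  has_derivative_on I T (f x) l ->
  is_derive x v (fun y => T (f y)) ((df : R) *: l).
Proof.
move=> Df fI DT; apply: cvg_is_derive; set s : R := f x.
(* The difference quotient of T at s, extended by its limit. *)
pose q (u : R) := if u == s then l else (u - s)^-1 *: (T u - T s).
have qE u : T u - T s = (u - s) *: q u.
  rewrite /q; case: eqP => [->|/eqP us]; first by rewrite !subrr scale0r.
  by rewrite scalerA divff ?scale1r // subr_eq0.
have c1 := derivable_cvg (@ex_derive _ _ _ _ _ _ _ Df); rewrite derive_val in c1.
have -> : (fun h : R => h^-1 *: (T (f (h *: v + x)) - T (f x)))
   = (fun h => (h^-1 *: (f (h *: v + x) - f x) : R) *: q (f (h *: v + x))).
  by apply/funext => h; rewrite qE scalerA.
apply: cvgZ => //.
apply/cvgrPdist_lt => e e0.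
move/cvgrPdist_lt : DT => /(_ e e0) DT.
have near_s : \forall u \near s, u \in I -> `|l - q u| < e.
  move: DT; rewrite !near_withinE /=; apply: filterS => u hu uI; rewrite /q.
  by case: eqP => [_|/eqP us]; [rewrite subrr normr0|exact: hu].
have line : h *: v + x @[h --> (0 : R)^'] --> x.
  exact: (cvg_line (is_derive_id x v)).
have := cvg_line Df near_s; rewrite !near_simpl => near_h.
have := line _ fI; rewrite !near_simpl => fIh.
near=> h.
have fh : (f (h *: v + x) : R) \in I by near: h.
by move: fh; near: h.
Unshelve. all: by end_near.
Qed.

End ProductAndChainRules.

Section Derivatives.
Local Open Scope classical_set_scope.
Variables (R : realType).

Lemma is_derive_big_sum (V W : normedModType R) (J : finType) (F : J -> V -> W)
    (dF : J -> W) x v :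
  (forall j, is_derive x v (F j) (dF j)) ->
  is_derive x v (fun y => \sum_j F j y) (\sum_j dF j).
Proof.
move=> h; suff H (l : seq J) : is_derive x v (fun y => \sum_(j <- l) F j y) (\sum_(j <- l) dF j).
  exact: H.
elim: l => [|j l IH].
  rewrite big_nil (_ : (fun y => _) = cst 0); first exact: is_derive_cst.
  by apply/funext => y; rewrite big_nil.
rewrite big_cons (_ : (fun y => _) = F j \+ (fun y => \sum_(j <- l) F j y)).
  exact: is_deriveD.
by apply/funext => y; rewrite big_cons.
Qed.

Variables (n : nat).
Local Notation N := (4 * n)%N.
Local Notation S := (quat R (n := n)).
Variables (U : set 'rV[R]_N) (f : 'rV[R]_N -> R).
Hypotheses (hU : open U) (hf : class_C 2 U f).
Variable x : 'rV[R]_N.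
Hypothesis Ux : U x.
Local Notation d p F := (partial (F : 'rV[R]_N -> R^o) p).

Definition hessian : 'M[R]_N := \matrix_(p, r) d p (d r f) x.

Lemma hessian_sym : hessian^T = hessian.
Proof.
apply/matrixP => p r; rewrite [LHS]mxE [LHS]mxE [RHS]mxE.
have [_ h] := hf.
have [dp [_ hp]] := h p; have [dr [_ hr]] := h r.
have [dpr [cpr _]] := hp r; have [drp [crp _]] := hr p.
apply: (@Clairaut R _ (f : 'rV[R]_N -> R^o) x (delta_mx 0 p) (delta_mx 0 r) U hU Ux).
- by move=> y Uy; split; [exact: dp|exact: dr].
- by move=> y Uy; split; [exact: dpr|exact: drp].
- exact: cpr.
- exact: crp.
Qed.

Lemma is_derive_grad p q i :
  is_derive x (delta_mx 0 p) (fun y => (grad f y *m S i) 0 q : R^o) ((hessian *m S i) p q).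
Proof.
rewrite mxE (_ : (fun y => _) = (fun y => \sum_r (d r f y : R) *: (S i r q : R^o))); last first.
  by apply/funext => y; rewrite mxE; apply: eq_bigr => r _; rewrite mxE.
apply: is_derive_big_sum => r.
have [_ h] := hf; have [_ [_ hr]] := h r; have [drp _] := hr p.
have := is_derive_scale (derivableP (drp x Ux)) (is_derive_cst (S i r q : R^o) x (delta_mx 0 p)).
by rewrite scaler0 addr0 [hessian p r]mxE.
Qed.

Lemma partial_grad p q i :
  partial (fun y => (grad f y *m S i) 0 q : R^o) p x = (hessian *m S i) p q.
Proof. by have := is_derive_grad p q i; move=> /@derive_val. Qed.

Variables (g : normedModType R) (br : g -> g -> g) (I : interval R) (T : 'I_3 -> R -> g).
Hypotheses (hfI : forall x, U x -> f x \in I) (hT : nahm br I T).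

Lemma partial_omega p q :
  partial (fun y => - \sum_i (grad f y *m S i) 0 q *: T i (f y)) p x
  = - \sum_i ((hessian *m S i) p q *: T i (f x)
      + (grad f x 0 p * (grad f x *m S i) 0 q)
        *: br (T (ordS i) (f x)) (T (ordS (ordS i)) (f x))).
Proof.
suff D : is_derive x (delta_mx 0 p) (fun y => \sum_i (grad f y *m S i) 0 q *: T i (f y))
   (\sum_i ((hessian *m S i) p q *: T i (f x)
      + (grad f x 0 p * (grad f x *m S i) 0 q)
        *: br (T (ordS i) (f x)) (T (ordS (ordS i)) (f x)))).
  by have /@derive_val := is_deriveN D.
apply: is_derive_big_sum => i.
have [_ h] := hf; have [dp _] := h p.
have fI : \forall y \near x, f y \in I.
  by apply: filterS (open_nbhs_nbhs (conj hU Ux)) => y /hfI.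
have DT := is_derive_comp_on (derivableP (dp x Ux)) fI (@hT i _ (hfI Ux)).
have := is_derive_scale (is_derive_grad p q i) DT.
by rewrite scalerA mulrC [grad f x 0 p]mxE.
Qed.

End Derivatives.

(** * Coordinates in a finite-dimensional normed space *)
Section FiniteDimension.
Local Open Scope classical_set_scope.
Variable R : realType.

Definition spanning (g : lmodType R) m (b : 'I_m -> g) : Prop :=
  forall v, exists c : 'I_m -> R, v = \sum_i c i *: b i.

Definition independent (g : lmodType R) m (b : 'I_m -> g) : Prop :=
  forall c : 'I_m -> R, \sum_i c i *: b i = 0 -> forall i, c i = 0.

(** As long as a spanning family is dependent, one vector can be removed. *)
Lemma finite_dimensional_basis (g : lmodType R) : finite_dimensional g ->
  exists (m : nat) (b : 'I_m -> g), spanning b /\ independent b.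
Proof.
case=> m; elim: m => [|m IH] [b sb].
  by exists 0%N, b; split => // c _ [].
have [ib|] := pselect (independent b); first by exists m.+1, b.
move=> /existsNP[c /not_implyP[c0 /existsNP[k /eqP ck]]].
apply: IH; exists (fun j => b (lift k j)) => v; have [a ->] := sb v.
exists (fun j => a (lift k j) - a k * c (lift k j) / c k).
(* Solve the linear relation for b k. *)
have bk : b k = - \sum_j (c (lift k j) / c k) *: b (lift k j).
  apply: (scalerI ck); rewrite scalerN scaler_sumr.
  move: c0; rewrite (bigD1_ord k) //= => /eqP; rewrite addr_eq0 => /eqP ->.
  by congr (- _); apply: eq_bigr => j _; rewrite scalerA mulrC divfK.
rewrite (bigD1_ord k) //= bk scalerN scaler_sumr -sumrN -big_split /=.
by apply: eq_bigr => j _; rewrite scalerA scalerBl mulrA addrC.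
Qed.

Variables (g : normedModType R) (m : nat) (b : 'I_m -> g).
Hypothesis ib : independent b.

Definition combination (x : 'rV[R]_m) : g := \sum_i x 0 i *: b i.

Lemma combination_continuous : continuous combination.
Proof.
rewrite /combination => x; move: (index_enum _) => l.
elim: l => [|i l IH].
  rewrite (_ : (fun x => _) = cst 0); first exact: cst_continuous.
  by apply/funext => y; rewrite big_nil.
rewrite (_ : (fun x => _) = (fun y : 'rV[R]_m => y 0 i *: b i + \sum_(j <- l) y 0 j *: b j)).
  exact: (cvgD (cvgZ (@coord_continuous R 1 m 0 i x) (cvg_cst (b i))) IH).
by apply/funext => y; rewrite big_cons.
Qed.

(** The norm of the combination has a positive minimum on the unit sphere, which
    is compact. *)
Lemma combination_norm : exists2 c : R, 0 < c & forall x, c * `|x| <= `|combination x|.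
Proof.
have combZ k x : combination (k *: x) = k *: combination x.
  by rewrite /combination scaler_sumr; apply: eq_bigr => i _; rewrite mxE scalerA.
pose A := [set x : 'rV[R]_m | `|x| = 1].
have normalize x : x != 0 -> A (`|x|^-1 *: x).
  by move=> x0; rewrite /A /= normrZ normfV normr_id mulVf // normr_eq0.
have [[y Ay]|A0] := pselect (A !=set0); last first.
  exists 1 => // x; have [->|/normalize Ax] := eqVneq x 0; first by rewrite normr0 mulr0.
  by exfalso; apply: A0; exists (`|x|^-1 *: x).
have cA : compact A.
  apply: bounded_closed_compact.
    by exists 1; split => // M M1 x /= ->; exact: ltW.
  rewrite (_ : A = (fun x : 'rV[R]_m => `|x|) @^-1` [set 1]) //.
  by apply: closed_comp; [move=> ? _; exact: norm_continuous|exact: closed_eq].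
have cF : {within A, continuous (fun x => `|combination x|)}.
  apply: continuous_subspaceT => x.
  exact: (continuous_comp (combination_continuous (x := x)) (@norm_continuous _ _ _)).
have [z] := EVT_min_rV (ex_intro _ y Ay) cA cF; rewrite inE => Az zmin.
exists `|combination z|.
  rewrite normr_gt0; apply/eqP => cz.
  have z0 : z = 0 by apply/rowP => i; rewrite mxE; exact: (ib cz).
  by move: Az; rewrite /A /= z0 normr0 => /esym/eqP; rewrite oner_eq0.
move=> x; have [->|x0] := eqVneq x 0; first by rewrite normr0 mulr0.
have := zmin (`|x|^-1 *: x); rewrite inE => /(_ (normalize x x0)).
rewrite combZ normrZ normfV normr_id mulrC.
by rewrite ler_pdivlMr ?normr_gt0.
Qed.

End FiniteDimension.

(** * Uniqueness for Nahm's equations *)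
Section Gronwall.
Local Open Scope classical_set_scope.
Variables (R : realType) (e de : R -> R) (a b C : R).
Hypothesis ab : a <= b.
Hypothesis ce : {within `[a, b], continuous e}.
Hypothesis De : forall s, s \in `]a, b[%R -> is_derive s (1 : R) e (de s).
Hypothesis le_de : forall s, s \in `]a, b[%R -> `|de s| <= C * e s.

Lemma is_derive_mul_exp (k s : R) : s \in `]a, b[%R ->
  is_derive s (1 : R) (fun u => e u * expR (k * u)) ((de s + k * e s) * expR (k * s)).
Proof.
move=> sab; have D1 := De sab.
have D2 : is_derive s (1 : R) (fun u : R => expR (k * u)) (k * expR (k * s)).
  have Dk : is_derive s (1 : R) (fun u : R => k * u) k.
    have := @is_deriveZ _ R R id k s 1 1 (is_derive_id s (1 : R)).
    by move=> D; apply: (is_derive_eq D); rewrite /GRing.scale /= mulr1.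
  by have := is_derive1_comp (is_derive_expR (k * s)) Dk; rewrite mulrC.
have D := is_deriveM D1 D2; apply: (is_derive_eq D).
by rewrite /GRing.scale /=; ring.
Qed.

Lemma continuous_mul_exp (k : R) : {within `[a, b], continuous (fun u => e u * expR (k * u))}.
Proof.
move/subspace_continuousP : ce => c; apply/subspace_continuousP => u uab.
have cexp : expR (k * v) @[v --> u] --> expR (k * u).
  by apply: continuous_comp; [exact: mulrl_continuous|exact: continuous_expR].
have cu := c u uab.
have cw : expR (k * v) @[v --> within `[a, b] (nbhs u)] --> expR (k * u).
  exact: cvg_within_filter.
by have := cvgM cu cw; apply; exact: within_filter.
Qed.

(** The function e(s) exp(-C s) is nonincreasing. *)
Lemma gronwall_forward : e a = 0 -> e b <= 0.
Proof.
move=> ea; rewrite -(pmulr_lle0 _ (expR_gt0 (- C * b))).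
have -> : 0 = e a * expR (- C * a) by rewrite ea mul0r.
apply: (ler0_derive1_nincr (a := a) (b := b) (f := fun u => e u * expR (- C * u))) => //.
- by move=> s sab; have := is_derive_mul_exp (- C) sab; move=> /@ex_derive.
- move=> s sab; rewrite derive1E; have := is_derive_mul_exp (- C) sab; move=> /@derive_val ->.
  rewrite pmulr_lle0 ?expR_gt0 // mulNr subr_le0.
  exact: le_trans (ler_norm _) (le_de sab).
- exact: continuous_mul_exp.
Qed.

(** The function e(s) exp(C s) is nondecreasing. *)
Lemma gronwall_backward : e b = 0 -> e a <= 0.
Proof.
move=> eb; rewrite -(pmulr_lle0 _ (expR_gt0 (C * a))).
have -> : 0 = e b * expR (C * b) by rewrite eb mul0r.
apply: (ger0_derive1_ndecr (a := a) (b := b) (f := fun u => e u * expR (C * u))) => //.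
- by move=> s sab; have := is_derive_mul_exp C sab; move=> /@ex_derive.
- move=> s sab; rewrite derive1E; have := is_derive_mul_exp C sab; move=> /@derive_val ->.
  rewrite pmulr_lge0 ?expR_gt0 // -lerBlDr sub0r lerNl.
  by apply: le_trans (le_de sab); rewrite -normrN; exact: ler_norm.
- exact: continuous_mul_exp.
Qed.

End Gronwall.

Section DerivativeOnInterval.
Local Open Scope classical_set_scope.
Variables (R : realType) (I : interval R).

Lemma itv_subset a b : a \in I -> b \in I -> forall s, s \in `[a, b]%R -> s \in I.
Proof.
move=> aI bI s; rewrite in_itv /=.
exact: (@interval_is_interval _ I a b aI bI s).
Qed.

Variables (t dt : R -> R).
Hypothesis Dt : forall s, s \in I -> has_derivative_on I (t : R -> R^o) s (dt s).

Lemma has_derivative_on_near s (e : R) : s \in I -> 0 < e ->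
  \forall u \near s, u \in I -> `|t u - t s - (u - s) * dt s| <= e * `|u - s|.
Proof.
move=> sI e0; have /cvgrPdist_lt /(_ e e0) := Dt sI.
rewrite !near_withinE /=; apply: filterS => u hu uI.
have [->|us] := eqVneq u s; first by rewrite !subrr mul0r subr0 normr0 mulr0.
have {}hu := hu us uI.
have -> : t u - t s - (u - s) * dt s = - ((u - s) * (dt s - (u - s)^-1 * (t u - t s))).
  by rewrite mulrBr mulrA divff ?subr_eq0 // mul1r opprB.
by rewrite normrN normrM mulrC ler_wpM2r // ltW.
Qed.

Lemma has_derivative_on_continuous a b : a \in I -> b \in I ->
  {within `[a, b], continuous t}.
Proof.
move=> aI bI; apply/subspace_continuousP => s sab.
have sI := itv_subset aI bI sab.
apply/cvgrPdist_lt => e e0.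
have k0 : 0 < 1 + `|dt s| by rewrite ltr_pwDl.
have near_t := has_derivative_on_near sI ltr01.
have near_u : \forall u \near s, `|s - u| < e / (1 + `|dt s|).
  have : id u @[u --> s] --> s by exact: cvg_id.
  by move/cvgrPdist_lt; apply; rewrite divr_gt0.
rewrite near_withinE; apply: filterS2 near_t near_u => u hu lt_u uab.
have := hu (itv_subset aI bI uab); rewrite mul1r => {}hu.
rewrite distrC -[t u - t s](subrK ((u - s) * dt s)).
apply: (le_lt_trans (ler_normD _ _)); rewrite normrM.
apply: (@le_lt_trans _ _ ((1 + `|dt s|) * `|u - s|)).
  by rewrite [leRHS]mulrDl mul1r lerD // mulrC.
by rewrite mulrC -ltr_pdivlMr // distrC.
Qed.

Lemma has_derivative_on_is_derive a b s : a \in I -> b \in I -> s \in `]a, b[%R ->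
  is_derive s (1 : R) (t : R -> R^o) (dt s).
Proof.
move=> aI bI sab; apply: cvg_is_derive; apply/cvgrPdist_le => e e0.
have sI : s \in I by apply: (itv_subset aI bI); exact: subset_itv_oo_cc.
have near_t := has_derivative_on_near sI e0.
have near_I : \forall u \near s, u \in I.
  by apply: filterS (near_in_itvoo sab) => u uab;
    apply: (itv_subset aI bI); exact: subset_itv_oo_cc.
have line : h *: (1 : R) + s @[h --> (0 : R)^'] --> s.
  exact: (cvg_line (is_derive_id s (1 : R))).
have near_h : \forall h \near (0 : R)^',
    (h *: (1 : R) + s \in I -> `|t (h *: (1 : R) + s) - t s - (h *: (1 : R) + s - s) * dt s|
      <= e * `|h *: (1 : R) + s - s|) /\ h *: (1 : R) + s \in I.
  exact: (line _ (filterI near_t near_I)).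
near=> h; have h0 : h != 0 by near: h; exact: nbhs_dnbhs_neq.
have [] := near near_h h; first by [].
rewrite [h *: 1]mulr1 addrK => ht /ht {}ht.
have -> : dt s - h^-1 *: (t (h + s) - t s) = - (h^-1 * (t (h + s) - t s - h * dt s)).
  by rewrite mulrBr mulrA mulVf // mul1r opprB.
by rewrite normrN normrM normfV ler_pdivrMl ?normr_gt0 // [leRHS]mulrC.
Unshelve. all: by end_near.
Qed.

End DerivativeOnInterval.

Section NahmUniqueness.
Local Open Scope classical_set_scope.
Variables (R : realType) (g : normedModType R) (br : g -> g -> g).
Hypotheses (hg : finite_dimensional g) (hbr : lie_bracket br).
Variables (I : interval R) (T : 'I_3 -> R -> g).
Hypothesis hT : nahm br I T.

(** Let E be the sum of the squares of the coordinates of T in a basis of the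
    Lie algebra.  The coordinates of T' are quadratic in those of T, so E' is
    cubic and |E'| <= C E on a compact interval, on which the coordinates of T
    are bounded. *)
Lemma nahm_vanishing s0 s1 : s0 \in I -> s1 \in I ->
  (forall i, T i s0 = 0) -> forall i, T i s1 = 0.
Proof.
move=> s0I s1I T0.
have [m [b [sb ib]]] := finite_dimensional_basis hg.
have coordP v : exists x, v = combination b x.
  have [c ->] := sb v; exists (\row_i c i).
  by apply: eq_bigr => i _; rewrite mxE.
have [coord coordE] := choice coordP.
have combB x y : combination b (x - y) = combination b x - combination b y.
  by rewrite /combination -sumrB; apply: eq_bigr => i _; rewrite !mxE scalerBl.
have combZ k x : combination b (k *: x) = k *: combination b x.
  by rewrite /combination scaler_sumr; apply: eq_bigr => i _; rewrite mxE scalerA.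
have comb_inj x y : combination b x = combination b y -> x = y.
  move=> xy; apply/eqP; rewrite -subr_eq0; apply/eqP/rowP => i; rewrite [RHS]mxE.
  by apply: (ib (fun i => (x - y) 0 i)); rewrite -/(combination b _) combB xy subrr.
have coordB v w : coord (v - w) = coord v - coord w.
  by apply: comb_inj; rewrite combB -!coordE.
have coordZ k v : coord (k *: v) = k *: coord v.
  by apply: comb_inj; rewrite combZ -!coordE.
have [c c0 norm_comb] := combination_norm ib.
have entry_le (x : 'rV[R]_m) k : `|x 0 k| <= `|x|.
  by rewrite [leRHS]/Num.Def.normr /= mx_normrE;
    apply: (le_bigmax _ (fun ij => `|x ij.1 ij.2|) (0, k)).
pose phi (ik : 'I_3 * 'I_m) s : R := coord (T ik.1 s) 0 ik.2.
pose psi (ik : 'I_3 * 'I_m) s : R :=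
  coord (br (T (ordS ik.1) s) (T (ordS (ordS ik.1)) s)) 0 ik.2.
have Dphi ik s : s \in I -> has_derivative_on I (phi ik : R -> R^o) s (psi ik s).
  move=> sI; apply/cvgrPdist_lt => e e0.
  have /cvgrPdist_lt /(_ (c * e) (mulr_gt0 c0 e0)) := @hT ik.1 s sI.
  apply: filterS => u; set l := br _ _; set q := _ *: _ => hu.
  have -> : psi ik s - (u - s)^-1 *: (phi ik u - phi ik s) = coord (l - q) 0 ik.2.
    by rewrite /psi /phi /l /q !coordB coordZ coordB !mxE.
  apply: (le_lt_trans (entry_le _ _)); rewrite -(ltr_pM2l c0).
  by apply: (le_lt_trans (norm_comb _)); rewrite -coordE.
(* Structure constants of the bracket. *)
pose gamma k l j : R := coord (br (b l) (b j)) 0 k.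
have psiE i k s : psi (i, k) s
    = \sum_l \sum_j gamma k l j * phi (ordS i, l) s * phi (ordS (ordS i), j) s.
  have coord_sum (J : finType) (F : J -> g) : coord (\sum_j F j) 0 k = \sum_j coord (F j) 0 k.
    have coord0 : coord 0 0 k = 0 by rewrite -[X in coord X](subrr 0) coordB subrr mxE.
    elim/big_rec2: _ => [//|j x y _ <-].
    by rewrite -[X in coord (_ + X)]opprK -[- y]sub0r coordB coordB !mxE coord0 sub0r opprK.
  rewrite /psi /= [X in br X _]coordE [X in br _ X]coordE /combination.
  rewrite br_suml // coord_sum; apply: eq_bigr => l _.
  rewrite br_sumr // coord_sum; apply: eq_bigr => j _.
  by rewrite brZl // brZr // !coordZ !mxE /gamma /phi /=; ring.
pose E s := \sum_ik phi ik s ^+ 2.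
have E_ge0 s : 0 <= E s by apply: sumr_ge0 => ik _; exact: sqr_ge0.
have phi_le ik s : phi ik s ^+ 2 <= E s.
  by rewrite /E (bigD1 ik) //= lerDl sumr_ge0 // => j _; exact: sqr_ge0.
have phi_mul ik jl s : `|phi ik s| * `|phi jl s| <= E s.
  have := phi_le ik s; have := phi_le jl s.
  rewrite -(real_normK (num_real (phi ik s))) -(real_normK (num_real (phi jl s))).
  have := sqr_ge0 (`|phi ik s| - `|phi jl s|); nra.
have E0 s : s \in I -> (forall i, T i s = 0) -> E s = 0.
  move=> _ Ts; rewrite /E big1 // => -[i k] _; rewrite /phi /= Ts.
  by rewrite -[X in coord X](subrr 0) coordB subrr mxE expr0n.
suff E1 : E s1 <= 0.
  move=> i; rewrite [LHS]coordE /combination big1 // => k _.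
  have := phi_le (i, k) s1; rewrite /phi /= => h.
  have : coord (T i s1) 0 k ^+ 2 <= 0 by apply: le_trans h E1.
  by rewrite le_eqVlt ltNge sqr_ge0 orbF sqrf_eq0 => /eqP ->; rewrite scale0r.
pose dE s := \sum_ik (phi ik s * psi ik s) *+ 2.
have interval_bound a be : a <= be -> a \in I -> be \in I -> exists C : R,
    [/\ {within `[a, be], continuous E},
      forall s, s \in `]a, be[%R -> is_derive s (1 : R) E (dE s) &
      forall s, s \in `]a, be[%R -> `|dE s| <= C * E s].
  move=> abe aI beI.
  have cE : {within `[a, be], continuous E}.
    apply/subspace_continuousP => s sab; rewrite /E; move: (index_enum _) => l.
    elim: l => [|ik l IH].
      rewrite (_ : (fun s => _) = cst 0); last by apply/funext => u; rewrite big_nil.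
      exact: cvg_cst.
    rewrite (_ : (fun s => _) = (fun u : R => phi ik u * phi ik u + \sum_(j <- l) phi j u ^+ 2)).
      have c1 : phi ik @ within `[a, be] (nbhs s) --> phi ik s.
        have /subspace_continuousP := has_derivative_on_continuous (Dphi ik) aI beI.
        exact.
      by apply: cvgD IH; apply: cvgM.
    by apply/funext => u; rewrite big_cons.
  have [z zab zmax] := EVT_max abe cE.
  exists (\sum_(ik : 'I_3 * 'I_m) (\sum_l \sum_j `|gamma ik.2 l j| * (1 + E z)) *+ 2); split.
  - exact: cE.
  - move=> s sab; apply: is_derive_big_sum => ik.
    have D := has_derivative_on_is_derive (Dphi ik) aI beI sab.
    have := is_deriveM D D; rewrite (_ : phi ik * phi ik = (fun u => phi ik u ^+ 2)) //.
  - move=> s sab; rewrite mulr_suml; apply: (le_trans (ler_norm_sum _ _ _)).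
    apply: ler_sum => -[i k] _; rewrite normrMn mulrnAl lerMn2r /=.
    rewrite normrM psiE mulr_suml.
    apply: (@le_trans _ _ (`|phi (i, k) s| * \sum_l \sum_j
        `|gamma k l j * phi (ordS i, l) s * phi (ordS (ordS i), j) s|)).
      apply: ler_wpM2l => //; apply: (le_trans (ler_norm_sum _ _ _)).
      by apply: ler_sum => l _; exact: ler_norm_sum.
    rewrite mulr_sumr; apply: ler_sum => l _; rewrite mulr_sumr mulr_suml.
    apply: ler_sum => j _; rewrite !normrM.
    have h1 := phi_mul (i, k) (ordS i, l) s.
    (* |x| <= 1 + x^2 *)
    have h2 : `|phi (ordS (ordS i), j) s| <= 1 + E z.
      have := phi_le (ordS (ordS i), j) s.
      have := zmax s (subset_itv_oo_cc sab).
      rewrite -(real_normK (num_real (phi (ordS (ordS i), j) s))).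
      have := normr_ge0 (phi (ordS (ordS i), j) s); nra.
    have h3 := E_ge0 s.
    rewrite mulrA [`|phi (i, k) s| * _]mulrA [`|phi (i, k) s| * _]mulrC -!mulrA.
    apply: ler_wpM2l => //; rewrite mulrA [leRHS]mulrC.
    by apply: ler_pM => //; exact: mulr_ge0.
case: (leP s0 s1) => [s01|/ltW s10].
  have [C [cE DE bE]] := interval_bound s0 s1 s01 s0I s1I.
  exact: (gronwall_forward s01 cE DE bE (E0 _ s0I T0)).
have [C [cE DE bE]] := interval_bound s1 s0 s10 s1I s0I.
exact: (gronwall_backward s10 cE DE bE (E0 _ s0I T0)).
Qed.

End NahmUniqueness.

(** * The equivalence *)
Theorem proposition3p6 (R : realType) (n : nat) (hn : (0 < n)%N)
    (g : normedModType R) (hg : finite_dimensional g)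
    (br : g -> g -> g) (hbr : lie_bracket br)
    (U : set 'rV[R]_(4 * n)) (hU : open U)
    (I : interval R)
    (f : 'rV[R]_(4 * n) -> R) (hf : class_C 2 U f)
    (hfI : forall x, U x -> f x \in I)
    (T : 'I_3 -> R -> g) (hT : nahm br I T)
    (hT0 : exists (i : 'I_3) (s : R), s \in I /\ T i s <> 0) :
  anti_self_dual br U (fun x => - omega f T x) <->
  (forall (i : 'I_3) (x : 'rV[R]_(4 * n)), U x ->
     wedge_real (dJdf f i x) (wedge_pow (Sigma R n) (n - 1))
     = c1 R n *: hodge (dJdf f i x)).
Proof.
have T_neq0 x : U x -> exists i, T i (f x) != 0.
  move=> Ux; have [i [s [sI Tis]]] := hT0.
  have [//|/forallNP T0] := pselect (exists i, T i (f x) != 0).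
  case: Tis; apply: (nahm_vanishing hg hbr hT (hfI _ Ux) sI) => j.
  by apply/eqP/negPn/negP; exact: T0.
have asd_at x (Ux : U x) := asd_curvatureP hn hbr (hessian_sym hU hf Ux)
  (fun i p q => partial_grad hf Ux p q i) (partial_omega hU hf Ux hfI hT) (T_neq0 x Ux).
split=> [asd i x Ux|dJ x Ux].
  by apply/asd_opP; move: i; apply/(asd_at x Ux)/asd_opP; exact: asd.
by apply/asd_opP/(asd_at x Ux) => i; apply/asd_opP; exact: dJ.
Qed.
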